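(* Let $\phi$ be an analytic self-map of $\mathbb{C}_+$ such that the composition operator $C_\phi f=f\circ\phi$ is bounded on $H^2(\mathbb{C}_+)$. For $r\in\mathbb{R}$ let $\tau_r(w)=w+ir$ and let $J_r:=C_{\tau_r}^{-1}W_0C_{\tau_r}$, where $(W_0f)(w)=\frac{1}{w}\overline{f\left(\frac{1}{\overline{w}}\right)}$ for $f\in H^2(\mathbb{C}_+)$ and $w\in\mathbb{C}_+$. Then $C_\phi$ is $J_r$-symmetric for some $r\in\mathbb{R}$ if and only if $\phi$ is a hyperbolic automorphism of $\mathbb{C}_+$, that is, $\phi(w)=aw+b$ with $a\in(0,1)\cup(1,\infty)$ and $\mathrm{Re}(b)=0$.
   Context: $\mathbb{C}_+=\{z\in\mathbb{C}:\mathrm{Re}(z)>0\}$. $H^2(\mathbb{C}_+)$ is the Hilbert space of analytic functions $f$ on $\mathbb{C}_+$ with $\|f\|=\left(\sup_{0<x<\infty}\frac{1}{\pi}\int_{-\infty}^{\infty}|f(x+iy)|^2\,dy\right)^{1/2}<\infty$. A conjugation on a Hilbert space $\mathcal{H}$ is a conjugate-linear operator $C$ with $C^2=I$ and $\langle Cx,Cy\rangle=\langle y,x\rangle$ for all $x,y\in\mathcal{H}$. A bounded operator $T$ is $C$-symmetric if $CT^*C=T$. The map $W_0$ is a conjugation on $H^2(\mathbb{C}_+)$, each $C_{\tau_r}$ is unitary on $H^2(\mathbb{C}_+)$, and hence each $J_r$ is a conjugation on $H^2(\mathbb{C}_+)$.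
   Formalization: The formal theorem also assumes that φ is not the identity map of ℂ₊: for φ = id the operator C_φ = I is J_r-symmetric for every r, yet φ is not of the form aw+b with a ≠ 1, so the claim as stated fails for that one map. *)

(* Defs.v *)
From HB Require Import structures.
From mathcomp Require Import all_boot all_order all_algebra.
From mathcomp Require Import all_classical all_reals all_analysis.
From mathcomp Require Import complex.

Set Implicit Arguments.
Unset Strict Implicit.
Unset Printing Implicit Defensive.

Import Order.TTheory GRing.Theory Num.Theory.
Import numFieldNormedType.Exports.

Local Open Scope classical_set_scope.
Local Open Scope ring_scope.
Local Open Scope complex_scope.

Section HardyRightHalfPlane.
Context {R : realType}.
Local Notation C := R[i].
Implicit Types (f g : C -> C) (z w : C).

Definition Cplus : set C := [set w | 0 < complex.Re w].

(* Elements of H^2(C_+) are represented by total functions C -> C of which only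
   the values on C_+ matter; the statements below compare them on C_+ only.  The
   increments in [derivable] range over C, so this is complex
   differentiability. *)
Definition analytic_on_Cplus f :=
  forall w, Cplus w -> derivable (f : C^o -> C^o) w 1.

Definition line_sqnorm f (x : R) : \bar R :=
  ((pi^-1)%:E *
   \int[lebesgue_measure]_(y in [set: R])
     (ComplexField.Normc.normc (f (x +i* y)) ^+ 2)%:E)%E.

Definition H2_sqnorm f : \bar R :=
  ereal_sup [set line_sqnorm f x | x in [set x : R | 0 < x]].

Definition in_H2 f := analytic_on_Cplus f /\ (H2_sqnorm f < +oo)%E.

Definition H2_norm f : R := Num.sqrt (fine (H2_sqnorm f)).

(* The inner product of H^2(C_+), linear in its first argument, recovered from
   the norm by polarization. *)
Definition H2_inner f g : C :=
  4^-1 * \sum_(k < 4)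
    'i%C ^+ k * (H2_norm (fun w => f w + 'i%C ^+ k * g w) ^+ 2)%:C.

Definition eq_on_Cplus f g := forall w, Cplus w -> f w = g w.

Definition operator := (C -> C) -> (C -> C).
Implicit Types (T S J : operator).

Definition maps_H2 T := forall f, in_H2 f -> in_H2 (T f).

Definition bounded_on_H2 T :=
  maps_H2 T /\
  exists M : R, forall f, in_H2 f -> H2_norm (T f) <= M * H2_norm f.

Definition is_adjoint T S :=
  maps_H2 S /\
  forall f g, in_H2 f -> in_H2 g -> H2_inner (T f) g = H2_inner f (S g).

(* An adjoint is unique on H^2(C_+), and exists for bounded T, so this says
   J T^* J = T. *)
Definition symmetric_wrt J T :=
  exists2 S, is_adjoint T S &
    forall f, in_H2 f -> eq_on_Cplus (J (S (J f))) (T f).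

Definition composition (phi : C -> C) : operator := fun f => f \o phi.

Definition tau (r : R) : C -> C := fun w => w + r *i.

Definition W0 : operator := fun f w => w^-1 * conjc (f (conjc w)^-1).

Lemma composition_tauK (r : R) :
  cancel (composition (tau r)) (composition (tau (- r))).
Proof.
move=> f; apply/funext => -[x y].
rewrite /composition /tau /=; congr f;
  apply/eqP; by rewrite eq_complex /= !addr0 addrNK !eqxx.
Qed.

Lemma composition_tauNK (r : R) :
  cancel (composition (tau (- r))) (composition (tau r)).
Proof. by move=> f; rewrite -{1}[r]opprK; exact: composition_tauK. Qed.

(* By the two lemmas above, composition with tau (- r) is the inverse of
   composition with tau r. *)
Definition Jr (r : R) : operator := fun f =>
  composition (tau (- r)) (W0 (composition (tau r) f)).

Definition self_map_Cplus (phi : C -> C) := forall w, Cplus w -> Cplus (phi w).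

(* The scale a = 1 is excluded: the identity is not hyperbolic, although the
   operator it induces is symmetric with respect to every conjugation. *)
Definition hyperbolic_automorphism (phi : C -> C) :=
  exists (a : R) (b : C),
    [/\ 0 < a < 1 \/ 1 < a, complex.Re b = 0
      & eq_on_Cplus phi (fun w => a%:C * w + b)].

End HardyRightHalfPlane.

(* Main.v *)
Require Import Defs.
From HB Require Import structures.
From mathcomp Require Import all_boot all_order all_algebra.
From mathcomp Require Import all_classical all_reals all_analysis.
From mathcomp Require Import complex.
From mathcomp Require Import measurable_realfun ring lra.

(* On H^2 the mean M(x) = int |f(x + iy)|^2 dy is nonincreasing.  Indeed, moving
   the line of integration Re z = x by d in f(z) conj(f(2x - conj z)), which
   equals |f|^2 on that line, gives M(x) <= (M(x + d) + M(x - d)) / 2, and a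
   bounded midpoint convex function on a half-line cannot increase.  Hence the
   squared norm, a supremum over lines, is the limit of M / pi at 0, so it is a
   quadratic form, and the Cauchy formula on the lines shows that
   K_w(z) = 1 / (z + conj w) satisfies <f, K_w> = 2 f(w).

   If C_phi is J_r-symmetric, then its adjoint maps K_w to K_(phi w), while
   (J_r K_w)(z) = 1 / (1 + (z - ir)(w - ir)).  Evaluating C_phi J_r K_w =
   J_r K_(phi w) yields (phi z - ir)(w - ir) = (z - ir)(phi w - ir); with
   w = 1 + ir, phi is the dilation about ir by A = phi(1 + ir) - ir, and A is
   real because phi preserves the half-plane.  Conversely, the adjoint of C_phi
   for phi(z) = az + b is a^-1 C_(phi^-1), and one takes for ir the fixed point
   of phi. *)

Set Implicit Arguments.
Unset Strict Implicit.
Unset Printing Implicit Defensive.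

Import Order.TTheory GRing.Theory Num.Theory.
Import numFieldNormedType.Exports.

Local Open Scope classical_set_scope.
Local Open Scope ring_scope.
Local Open Scope complex_scope.

Local Notation normc := ComplexField.Normc.normc.
Local Notation Re := complex.Re.
Local Notation Im := complex.Im.


(** * Complex differentiability *)

(** The obstacle is the form of the norm: a supremum over lines satisfies no evident parallelogram
    law, so the inner product polarized from it is not visibly conjugate symmetric or even
    homogeneous. No boundary values are introduced; identities are proved for integrals over a line
    inside the half-plane, where they hold integrand by integrand, and are carried to the limit at
    the imaginary axis. The second obstacle is convergence of contour integrals: an H^2 function is
    controlled only in mean over vertical lines, so Tonelli's theorem has to supply heights at which
    the horizontal edges contribute little. Contour integrals are kept real: only the imaginary part
    of the integral of g dz is used, and the missing half of the kernel formula is recovered by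
    applying it to -i f. The factor 2 in <f, K_w> = 2 f(w) comes from norming by 1 / pi where the
    Cauchy formula has 1 / (2 pi). *)

Section ComplexBasics.
Context {R : realType}.
Local Notation C := R[i].
Implicit Types (z w : C) (g f : C -> C).

Lemma normC_normc z : `|z| = (normc z)%:C.
Proof. by rewrite normc_def; case: z. Qed.

Lemma sqr_normcE z : normc z ^+ 2 = Re z ^+ 2 + Im z ^+ 2.
Proof. by case: z => a b /=; rewrite sqr_sqrtr// addr_ge0 ?sqr_ge0. Qed.

Lemma normc_ge0 z : 0 <= normc z.
Proof. by case: z => a b; exact: sqrtr_ge0. Qed.

Lemma normc_gt0 z : z != 0 -> 0 < normc z.
Proof. by move=> z0; rewrite -ltcR -normC_normc normr_gt0. Qed.

Lemma normcB z w : normc (z - w) = normc (w - z).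
Proof. by rewrite -opprB normcN. Qed.

Lemma Re_le_normc z : `|Re z| <= normc z.
Proof. by have := normc_ge_Re z; rewrite normC_normc lecR. Qed.

Lemma Im_le_normc z : `|Im z| <= normc z.
Proof.
case: z => a b /=; rewrite -[X in X <= _]sqrtr_sqr ler_wsqrtr//.
by rewrite ?sqr_sqrtr// lerDr sqr_ge0.
Qed.

Lemma normc_conj z : normc (conjc z) = normc z.
Proof. by case: z => a b /=; rewrite sqrrN. Qed.

Lemma normcR (x : R) : normc x%:C = `|x|.
Proof. by rewrite /= expr0n addr0 sqrtr_sqr. Qed.

Lemma normc_le_ReIm z : normc z <= `|Re z| + `|Im z|.
Proof.
rewrite -ler_sqr ?nnegrE ?normc_ge0 ?addr_ge0// sqr_normcE sqrrD.
by rewrite !real_normK ?num_real// lerD2r lerDl mulrn_wge0// mulr_ge0.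
Qed.

Lemma ReD z w : Re (z + w) = Re z + Re w. Proof. by case: z; case: w. Qed.
Lemma ImD z w : Im (z + w) = Im z + Im w. Proof. by case: z; case: w. Qed.
Lemma ReN z : Re (- z) = - Re z. Proof. by case: z. Qed.
Lemma ImN z : Im (- z) = - Im z. Proof. by case: z. Qed.
Lemma ReM z w : Re (z * w) = Re z * Re w - Im z * Im w.
Proof. by case: z; case: w. Qed.
Lemma ImM z w : Im (z * w) = Re z * Im w + Im z * Re w.
Proof. by case: z; case: w. Qed.
Lemma ReJ z : Re (conjc z) = Re z. Proof. by case: z. Qed.
Lemma ImJ z : Im (conjc z) = - Im z. Proof. by case: z. Qed.

Definition ReImE := (ReD, ImD, ReN, ImN, ReM, ImM, ReJ, ImJ).

Lemma ReImP z w : Re z = Re w -> Im z = Im w -> z = w.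
Proof. by case: z; case: w => ? ? ? ? /= -> ->. Qed.

Lemma neq0_Re z : Re z != 0 -> z != 0.
Proof. by apply: contraNneq => ->. Qed.

Definition holo g z := derivable (g : C^o -> C^o) z 1.

(** In this form, free of quotients, the increment h = 0 is harmless, conjugation and affine
    substitution carry the estimate along, and it is the linear approximation that Goursat's
    argument needs. *)
Lemma holoP g z : holo g z <-> exists l, forall e : R, 0 < e ->
  exists2 d : R, 0 < d & forall h, normc h < d ->
    normc (g (z + h) - g z - l * h) <= e * normc h.
Proof.
split.
- move=> /cvg_ex[/= l] /cvgrPdist_le gl; exists l => e e0.
  have e0' : 0 < e%:C by rewrite ltcR.
  have [d /= d0 dP] := gl _ e0'.
  have dE : d = (Re d)%:C.
    by move: d0; rewrite ltcE /= => /andP[/eqP d0 _]; apply: ReImP.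
  exists (Re d); first by move: d0; rewrite ltcE => /andP[].
  move=> h hd; have [->|h0] := eqVneq h 0.
    by rewrite addr0 mulr0 subr0 subrr ComplexField.Normc.normc0 mulr0.
  have /= := dP h; rewrite sub0r normrN => H.
  have : `|h| < d by rewrite dE normC_normc ltcR.
  move=> /H /(_ h0); rewrite normC_normc lecR => {}H.
  have -> : g (z + h) - g z - l * h =
      - (l - h^-1 *: (g (h *: 1 + z) - g z)) * h.
    rewrite /GRing.scale /= mulr1 (addrC h) opprB mulrBl mulrAC mulVf// mul1r.
    by [].
  by rewrite ComplexField.Normc.normcM normcN ler_wpM2r// normc_ge0.
- move=> [l lP]; apply/cvg_ex; exists l; apply/cvgrPdist_le => /= e e0.
  have eE : e = (Re e)%:C.
    by move: e0; rewrite ltcE /= => /andP[/eqP e0 _]; apply: ReImP.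
  have [d d0 dP] : exists2 d : R, 0 < d & forall h, normc h < d ->
      normc (g (z + h) - g z - l * h) <= Re e * normc h.
    by apply: lP; rewrite -ltcR -eE.
  exists d%:C => /=; first by rewrite ltcR.
  move=> h /=; rewrite sub0r normrN => hd h0.
  have hd' : normc h < d by rewrite -ltcR -normC_normc.
  rewrite eE normC_normc lecR.
  have h0' : 0 < normc h by exact: normc_gt0.
  rewrite -(ler_pM2r h0') -ComplexField.Normc.normcM.
  apply: le_trans (dP _ hd'); rewrite -normcN.
  rewrite /GRing.scale /= mulr1 (addrC h) mulrBl mulrAC mulVf// mul1r opprB.
  by [].
Qed.

Lemma holo_cont g z : holo g z -> forall e : R, 0 < e ->
  exists2 d : R, 0 < d & forall w, normc (w - z) < d -> normc (g w - g z) < e.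
Proof.
move=> /holoP[l lP] e e0.
have [d d0 dP] := lP 1 ltr01.
have k0 : 0 < normc l + 1 by rewrite ltr_wpDl// normc_ge0.
exists (Num.min d (e / (normc l + 1))).
  by rewrite lt_min d0 divr_gt0.
move=> w; rewrite lt_min => /andP[wd we].
have := dP _ wd; rewrite [z + _]addrC subrK => H.
have -> : g w - g z = (g w - g z - l * (w - z)) + l * (w - z)
  by rewrite [RHS]subrK.
apply: le_lt_trans (le_normcD _ _) _; rewrite ComplexField.Normc.normcM.
apply: (@le_lt_trans _ _ ((normc l + 1) * normc (w - z))).
  by rewrite mulrDl addrC lerD2l.
by rewrite mulrC -ltr_pdivlMr.
Qed.

Lemma holo_near f g z (d : R) : 0 < d ->
  (forall w, normc (w - z) < d -> f w = g w) -> holo f z -> holo g z.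
Proof.
move=> d0 fg /holoP[l lP]; apply/holoP; exists l => e e0.
have [d' d'0 d'P] := lP e e0.
exists (Num.min d d'); first by rewrite lt_min d0.
move=> h; rewrite lt_min => /andP[hd hd'].
rewrite -!fg; first exact: d'P.
- by rewrite subrr ComplexField.Normc.normc0.
- by rewrite addrC addKr.
Qed.

Lemma holo_cst (c z : C) : holo (fun=> c) z.
Proof. exact: derivable_cst. Qed.

Lemma holo_id z : holo id z.
Proof. exact: derivable_id. Qed.

Lemma holoD f g z : holo f z -> holo g z -> holo (fun w => f w + g w) z.
Proof. exact: derivableD. Qed.

Lemma holoN f z : holo f z -> holo (fun w => - f w) z.
Proof. exact: derivableN. Qed.

Lemma holoB f g z : holo f z -> holo g z -> holo (fun w => f w - g w) z.
Proof. by move=> ff gg; exact: (holoD ff (holoN gg)). Qed.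

Lemma holoM f g z : holo f z -> holo g z -> holo (fun w => f w * g w) z.
Proof. exact: derivableM. Qed.

Lemma holoV f z : f z != 0 -> holo f z -> holo (fun w => (f w)^-1) z.
Proof. exact: derivableV. Qed.

Lemma holo_affine f (a b : C) z : holo f (a * z + b) ->
  holo (fun w => f (a * w + b)) z.
Proof.
move=> /holoP[l lP]; apply/holoP; exists (l * a) => e e0.
have k0 : 0 < normc a + 1 by rewrite ltr_wpDl// normc_ge0.
have [d d0 dP] := lP (e / (normc a + 1)) (divr_gt0 e0 k0).
exists (d / (normc a + 1)); first by rewrite divr_gt0.
move=> h hd.
have -> : a * (z + h) + b = a * z + b + a * h by ring.
rewrite -(mulrA l).
have ah : normc (a * h) <= (normc a + 1) * normc h.
  by rewrite ComplexField.Normc.normcM ler_wpM2r ?normc_ge0// lerDl.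
apply: le_trans (dP _ _) _.
  apply: le_lt_trans ah _; by rewrite mulrC -ltr_pdivlMr.
apply: le_trans (ler_wpM2l (ltW (divr_gt0 e0 k0)) ah) _.
by rewrite mulrA divfK ?gt_eqF.
Qed.

(* Schwarz reflection in the line [Re = s / 2]. *)
Lemma holo_reflect f (s : R) z : holo f (s%:C - conjc z) ->
  holo (fun w => conjc (f (s%:C - conjc w))) z.
Proof.
move=> /holoP[l lP]; apply/holoP; exists (- conjc l) => e e0.
have [d d0 dP] := lP e e0; exists d => // h hd.
have := dP (- conjc h); rewrite normcN normc_conj => /(_ hd).
rewrite -normc_conj; congr (normc _ <= _).
rewrite !rmorphB !rmorphM !rmorphN /= !conjcK !rmorphD.
by rewrite opprD addrA mulrN mulNr.
Qed.

End ComplexBasics.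

(** * Goursat's theorem for rectangles *)

Section Bisection.
Context {R : realType}.
Local Notation C := R[i].
Local Notation mu := (@lebesgue_measure R).
Implicit Types (g : C -> C).

(** Every left endpoint lies below every right endpoint, so the supremum of the left endpoints
    works. *)
Lemma nested_intervals (u w : nat -> R) : (forall n, 0 <= w n) ->
  (forall n, u n <= u n.+1) -> (forall n, u n.+1 + w n.+1 <= u n + w n) ->
  exists c, forall n, u n <= c <= u n + w n.
Proof.
move=> w0 u_incr uw_decr.
have u_le m n : (m <= n)%N -> u m <= u n.
  elim: n => [|n IH]; first by rewrite leqn0 => /eqP ->.
  rewrite leq_eqVlt => /predU1P[->//|/IH H]; exact: le_trans H (u_incr n).
have uw_le m n : (m <= n)%N -> u n + w n <= u m + w m.
  elim: n => [|n IH]; first by rewrite leqn0 => /eqP ->.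
  rewrite leq_eqVlt => /predU1P[->//|/IH H]; exact: le_trans (uw_decr n) H.
have u_uw m n : u m <= u n + w n.
  have [mn|/ltnW nm] := leqP m n.
    by apply: le_trans (u_le _ _ mn) _; rewrite lerDl.
  by apply: le_trans _ (uw_le _ _ nm); rewrite lerDl.
exists (sup (range u)) => n; apply/andP; split.
  apply: ub_le_sup; last by exists n.
  by exists (u 0%N + w 0%N) => _ [m _ <-].
by apply: ge_sup; [exists (u 0%N), 0%N | move=> _ [m _ <-]].
Qed.

(* [P x y w h] speaks of the rectangle [[x, x + w] * [y, y + h]]. *)
Lemma rectangle_bisection (P : R -> R -> R -> R -> Prop) (x0 y0 w0 h0 : R) :
  0 <= w0 -> 0 <= h0 ->
  (forall x y w h, 0 <= w -> 0 <= h -> x0 <= x -> x + w <= x0 + w0 ->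
    y0 <= y -> y + h <= y0 + h0 ->
    P x y (w / 2) (h / 2) -> P (x + w / 2) y (w / 2) (h / 2) ->
    P x (y + h / 2) (w / 2) (h / 2) ->
    P (x + w / 2) (y + h / 2) (w / 2) (h / 2) -> P x y w h) ->
  (forall p q, x0 <= p <= x0 + w0 -> y0 <= q <= y0 + h0 ->
    exists2 d : R, 0 < d & forall x y w h, x0 <= x -> x + w <= x0 + w0 ->
      y0 <= y -> y + h <= y0 + h0 -> x <= p <= x + w -> y <= q <= y + h ->
      0 <= w < d -> 0 <= h < d -> P x y w h) ->
  P x0 y0 w0 h0.
Proof.
move=> w00 h00 quarter loc; apply: contrapT => nP0.
pose W n := w0 / 2 ^+ n; pose H n := h0 / 2 ^+ n.
have W0 n : 0 <= W n by rewrite divr_ge0// exprn_ge0.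
have H0 n : 0 <= H n by rewrite divr_ge0// exprn_ge0.
have WS n : W n.+1 = W n / 2 by rewrite /W exprSr invfM mulrA.
have HS n : H n.+1 = H n / 2 by rewrite /H exprSr invfM mulrA.
pose good n (s t : R * R) := [/\ ~ P t.1 t.2 (W n.+1) (H n.+1),
  t.1 = s.1 \/ t.1 = s.1 + W n.+1 & t.2 = s.2 \/ t.2 = s.2 + H n.+1].
(* The default [s m] is never taken while [inv m] holds: if all four quarters satisfied [P], so
   would the rectangle itself. *)
pose fix s n : R * R :=
  if n is m.+1 then xget (s m) (good m (s m)) else (x0, y0).
pose inv n := [/\ x0 <= (s n).1, (s n).1 + W n <= x0 + w0,
  y0 <= (s n).2, (s n).2 + H n <= y0 + h0 & ~ P (s n).1 (s n).2 (W n) (H n)].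
have sgood n : inv n -> good n (s n) (s n.+1).
  move=> [i1 i2 i3 i4 i5] /=; case: xgetP => [t -> //|ng]; exfalso.
  apply: i5; apply: (quarter) => //; rewrite -?WS -?HS; apply: contrapT => nP.
  - by apply: (ng ((s n).1, (s n).2)); split => //; left.
  - by apply: (ng ((s n).1 + W n.+1, (s n).2)); split => //; [right|left].
  - by apply: (ng ((s n).1, (s n).2 + H n.+1)); split => //; [left|right].
  - by apply: (ng ((s n).1 + W n.+1, (s n).2 + H n.+1)); split => //; right.
have sinv n : inv n.
  elim: n => [|n IH].
    rewrite /inv /= /W /H expr0 !divr1; split => //.
  have [g1 g2 g3] := sgood n IH; have [i1 i2 i3 i4 i5] := IH.
  have := W0 n; have := H0 n; have := WS n; have := HS n => e1 e2 e3 e4.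
  split => //; [case: g2|case: g2|case: g3|case: g3] => ->; lra.
have sG n := sgood n (sinv n).
have [p pP] : exists c, forall n, (s n).1 <= c <= (s n).1 + W n.
  apply: nested_intervals => // n; have [_ g2 _] := sG n; have := W0 n;
    have := WS n => e1 e2; case: g2 => ->; lra.
have [q qP] : exists c, forall n, (s n).2 <= c <= (s n).2 + H n.
  apply: nested_intervals => // n; have [_ _ g2] := sG n; have := H0 n;
    have := HS n => e1 e2; case: g2 => ->; lra.
have [d d0 dP] : exists2 d : R, 0 < d & forall x y w h, x0 <= x ->
      x + w <= x0 + w0 ->
      y0 <= y -> y + h <= y0 + h0 -> x <= p <= x + w -> y <= q <= y + h ->
      0 <= w < d -> 0 <= h < d -> P x y w h.
  apply: loc.
    by have := pP 0%N; rewrite /= /W expr0 divr1.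
  by have := qP 0%N; rewrite /= /H expr0 divr1.
have [n wn] : exists n, w0 + h0 < d * 2 ^+ n.
  exists (Num.bound ((w0 + h0) / d)); rewrite mulrC -ltr_pdivrMr//.
  exact: upper_nthrootP.
have [i1 i2 i3 i4] := sinv n; apply; apply: dP => //.
  rewrite W0 /W ltr_pdivrMr ?exprn_gt0//; lra.
rewrite H0 /H ltr_pdivrMr ?exprn_gt0//; lra.
Qed.

End Bisection.

(** * Boundary integrals of rectangles *)

Section Goursat.
Context {R : realType}.
Local Notation C := R[i].
Local Notation mu := (@lebesgue_measure R).
Implicit Types (g : C -> C).

Lemma continuousP_dist (f : R -> R) x : {for x, continuous f} <->
  forall e, 0 < e ->
    exists2 d, 0 < d & forall y, `|y - x| < d -> `|f y - f x| < e.
Proof.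
split.
- move=> /cvgrPdist_lt fx e e0; have [d /= d0 dP] := fx e e0.
  by exists d => // y yd; rewrite distrC; apply: dP; rewrite /= distrC.
- move=> fx; apply/cvgrPdist_lt => e e0; have [d d0 dP] := fx e e0.
  by exists d => //= y yd; rewrite distrC; apply: dP; rewrite distrC.
Qed.

Lemma Re_cont_v g x y : holo g (x +i* y) ->
  {for y, continuous (fun t => Re (g (x +i* t)))}.
Proof.
move=> /holo_cont gz; apply: (proj2 (continuousP_dist _ _)) => e e0.
have [d d0 dP] := gz e e0; exists d => // t td.
rewrite -[X in _ - X]opprK -ReN opprK -ReD.
apply: le_lt_trans (Re_le_normc _) _; apply: dP.
by apply: le_lt_trans (normc_le_ReIm _) _; rewrite /= subrr normr0 add0r.
Qed.

Lemma Im_cont_h g x y : holo g (x +i* y) ->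
  {for x, continuous (fun t => Im (g (t +i* y)))}.
Proof.
move=> /holo_cont gz; apply: (proj2 (continuousP_dist _ _)) => e e0.
have [d d0 dP] := gz e e0; exists d => // t td.
rewrite -[X in _ - X]opprK -ImN opprK -ImD.
apply: le_lt_trans (Im_le_normc _) _; apply: dP.
by apply: le_lt_trans (normc_le_ReIm _) _; rewrite /= subrr normr0 addr0.
Qed.

Lemma integrable_seg (f : R -> R) a b : a <= b ->
  (forall x, a <= x <= b -> {for x, continuous f}) ->
  mu.-integrable `[a, b] (EFin \o f).
Proof.
move=> ab fc; apply: continuous_compact_integrable.
  exact: segment_compact.
apply: continuous_in_subspaceT => x; rewrite inE /= in_itv /= => xab.
exact: fc.
Qed.

Lemma seg_split (f : R -> R) a m b : a <= m <= b ->
  (forall x, a <= x <= b -> {for x, continuous f}) ->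
  \int[mu]_(x in `[a, b]) f x =
  \int[mu]_(x in `[a, m]) f x + \int[mu]_(x in `[m, b]) f x.
Proof.
move=> /andP[am mb] fc.
have iab : mu.-integrable `[a, b] (EFin \o f).
  by apply: integrable_seg => //; exact: le_trans mb.
have imb : mu.-integrable `[m, b] (EFin \o f).
  apply: integrable_seg => // x /andP[mx xb]; apply: fc.
  by rewrite (le_trans am mx).
rewrite -(Rintegral_itv_obnd_cbnd (r := m)); last first.
  by apply: integrableS imb => //; exact: subset_itv_oc_cc.
have := @Rintegral_itvB R f (BLeft a) (BRight b) m iab.
rewrite !bnd_simp => /(_ am mb) <-.
by rewrite addrC subrK.
Qed.

(** Integrate K - E <= f <= K + E. With K = 0 this is the length estimate; with K read off a linear
    approximation it isolates the main term. *)
Lemma seg_near (f : R -> R) a b K E : a <= b ->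
  (forall x, a <= x <= b -> {for x, continuous f}) ->
  (forall x, a <= x <= b -> `|f x - K| <= E) ->
  `|\int[mu]_(x in `[a, b]) f x - K * (b - a)| <= E * (b - a).
Proof.
move=> ab fc fE.
have muab : fine (mu `[a, b]%classic) = b - a.
  rewrite lebesgue_measure_itv /= lte_fin.
  by case: ltgtP ab => // -> _; rewrite subrr.
have ic (k : R) : mu.-integrable `[a, b] (EFin \o (cst k)).
  by apply: integrable_seg => // x _; exact: cst_continuous.
have fi := integrable_seg ab fc.
have cE (k : R) : \int[mu]_(x in `[a, b]) k = k * (b - a).
  by rewrite Rintegral_cst // muab.
rewrite ler_norml lerBrDr lerBlDr -mulNr -!mulrDl -!cE; apply/andP; split.
  apply: le_Rintegral => //; first exact: ic.
  move=> x /=; rewrite in_itv /= => /fE.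
  by rewrite ler_norml => /andP[]; rewrite lerBrDr.
apply: le_Rintegral => //; first exact: ic.
move=> x /=; rewrite in_itv /= => /fE.
by rewrite ler_norml => /andP[_]; rewrite lerBlDr.
Qed.

(* The imaginary part of the integral of [g dz] along the boundary of
   [[a, b] * [c, d]]. *)
Definition rect_int g a b c d : R :=
  \int[mu]_(x in `[a, b]) (Im (g (x +i* c)) - Im (g (x +i* d))) +
  \int[mu]_(y in `[c, d]) (Re (g (b +i* y)) - Re (g (a +i* y))).

Definition holo_rect g a b c d :=
  forall x y, a <= x <= b -> c <= y <= d -> holo g (x +i* y).

(** Holomorphy is asked along single segments, so that a rectangle around a puncture can still be
    cut along lines avoiding the puncture. *)
Definition holo_h g a b y := forall x, a <= x <= b -> holo g (x +i* y).
Definition holo_v g c d x := forall y, c <= y <= d -> holo g (x +i* y).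

Lemma holo_rect_h g a b c d y : holo_rect g a b c d -> c <= y <= d ->
  holo_h g a b y.
Proof. by move=> gh yP x xP; exact: gh. Qed.

Lemma holo_rect_v g a b c d x : holo_rect g a b c d -> a <= x <= b ->
  holo_v g c d x.
Proof. by move=> gh yP y xP; exact: gh. Qed.

Lemma cont_h g a b y y' x : holo_h g a b y -> holo_h g a b y' ->
  a <= x <= b ->
  {for x, continuous (fun x => Im (g (x +i* y)) - Im (g (x +i* y')))}.
Proof.
by move=> gy gy' xP; apply: continuousB; apply: Im_cont_h;
  [exact: gy|exact: gy'].
Qed.

Lemma cont_v g c d x x' y : holo_v g c d x -> holo_v g c d x' ->
  c <= y <= d ->
  {for y, continuous (fun y => Re (g (x +i* y)) - Re (g (x' +i* y)))}.
Proof.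
by move=> gy gy' xP; apply: continuousB; apply: Re_cont_v;
  [exact: gy|exact: gy'].
Qed.

Lemma rect_int_splitx g a m b c d : a <= m <= b -> c <= d ->
  holo_h g a b c -> holo_h g a b d ->
  holo_v g c d a -> holo_v g c d m -> holo_v g c d b ->
  rect_int g a b c d = rect_int g a m c d + rect_int g m b c d.
Proof.
move=> amb cd hc hd va vm vb.
rewrite /rect_int (seg_split amb); last by move=> x; exact: cont_h hc hd.
rewrite -!addrA; congr (_ + _); rewrite addrCA; congr (_ + _).
rewrite -RintegralD//; first last.
- by apply: integrable_seg => // y; exact: cont_v.
- by apply: integrable_seg => // y; exact: cont_v.
by apply: eq_Rintegral => y _; ring.
Qed.

Lemma rect_int_splity g a b c m d : a <= b -> c <= m <= d ->
  holo_h g a b c -> holo_h g a b m -> holo_h g a b d ->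
  holo_v g c d a -> holo_v g c d b ->
  rect_int g a b c d = rect_int g a b c m + rect_int g a b m d.
Proof.
move=> ab cmd hc hm hd va vb.
rewrite /rect_int (seg_split cmd); last by move=> x; exact: cont_v vb va.
rewrite !addrA; congr (_ + _); rewrite addrAC; congr (_ + _).
rewrite -RintegralD//; first last.
- by apply: integrable_seg => // y; exact: cont_h.
- by apply: integrable_seg => // y; exact: cont_h.
by apply: eq_Rintegral => y _; ring.
Qed.

Lemma rect_int_bound g a b c d M : a <= b -> c <= d ->
  holo_h g a b c -> holo_h g a b d -> holo_v g c d a -> holo_v g c d b ->
  (forall x, a <= x <= b ->
    normc (g (x +i* c)) <= M /\ normc (g (x +i* d)) <= M) ->
  (forall y, c <= y <= d ->
    normc (g (a +i* y)) <= M /\ normc (g (b +i* y)) <= M) ->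
  `|rect_int g a b c d| <= 2 * M * ((b - a) + (d - c)).
Proof.
move=> ab cd hc hd va vb hM vM; apply: le_trans (ler_normD _ _) _.
rewrite mulrDr; apply: lerD.
- have := @seg_near (fun x =>
    Im (g (x +i* c)) - Im (g (x +i* d))) a b 0 (2 * M) ab.
  rewrite mul0r subr0; apply => x xP; first exact: cont_h hc hd xP.
  have [h1 h2] := hM x xP; rewrite subr0 (le_trans (ler_normB _ _))//.
  rewrite mulr2n mulrDl mul1r lerD//; exact: le_trans (Im_le_normc _) _.
- have := @seg_near (fun y =>
    Re (g (b +i* y)) - Re (g (a +i* y))) c d 0 (2 * M) cd.
  rewrite mul0r subr0; apply => x xP; first exact: cont_v vb va xP.
  have [h1 h2] := vM x xP; rewrite subr0 (le_trans (ler_normB _ _))//.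
  rewrite mulr2n mulrDl mul1r lerD//; exact: le_trans (Re_le_normc _) _.
Qed.

(** The linear approximation at p + iq contributes nothing: its slope l gives - h Re l times w from
    the horizontal sides and w Re l times h from the vertical ones. The error is at most e / 2 (w +
    h) at each point, hence e (w + h) for each difference of two values. *)
Lemma rect_int_local g p q e : 0 < e -> holo g (p +i* q) ->
  exists2 d : R, 0 < d & forall x y w h, x <= p <= x + w -> y <= q <= y + h ->
    0 <= w < d -> 0 <= h < d -> holo_rect g x (x + w) y (y + h) ->
    `|rect_int g x (x + w) y (y + h)| <= e * (w + h) ^+ 2.
Proof.
move=> e0 /holoP[l lP]; have e2 : 0 < e / 2 by rewrite divr_gt0.
have [d d0 dP] := lP _ e2; exists (d / 2); first by rewrite divr_gt0.
move=> x y w h xp yq /andP[w0 wd] /andP[h0 hd] gh.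
have near s t : x <= s <= x + w -> y <= t <= y + h ->
    normc (g (s +i* t) - g (p +i* q) - l * ((s - p) +i* (t - q)))
    <= e / 2 * (w + h).
  move=> sP tP; have H := dP ((s - p) +i* (t - q)).
  have -> : s +i* t = p +i* q + ((s - p) +i* (t - q)).
    by apply: ReImP; rewrite /= addrC subrK.
  have le1 : normc ((s - p) +i* (t - q)) <= w + h.
    apply: le_trans (normc_le_ReIm _) _; rewrite /= lerD// ler_norml;
      apply/andP; split; lra.
  apply: le_trans (H _) _; first by lra.
  by rewrite ler_wpM2l// ltW.
have xw : x <= x + w by lra.
have yh : y <= y + h by lra.
have H1 := @seg_near (fun s => Im (g (s +i* y)) - Im (g (s +i* (y + h))))
  x (x + w) (- h * Re l) (e * (w + h)) xw.
have H2 := @seg_near (fun t => Re (g ((x + w) +i* t)) - Re (g (x +i* t)))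
  y (y + h) (w * Re l) (e * (w + h)) yh.
have {H1} := H1 _ _; have {H2} := H2 _ _; rewrite /rect_int.
set I1 := \int[mu]_(_ in _) _; set I2 := \int[mu]_(_ in _) _.
move=> H2 H1.
have {H1} : `|I2 - - h * Re l * (x + w - x)| <= e * (w + h) * (x + w - x).
  apply: H1 => s sP.
    by apply: cont_h sP; apply: (holo_rect_h gh); rewrite lexx yh.
  have := near s y sP; rewrite lexx yh => /(_ isT).
  have := near s (y + h) sP; rewrite lexx yh => /(_ isT).
  move=> /(le_trans (Im_le_normc _)) + /(le_trans (Im_le_normc _)).
  rewrite !ReImE /= !ler_norml; lra.
have {H2} : `|I1 - w * Re l * (y + h - y)| <= e * (w + h) * (y + h - y).
  apply: H2 => s sP.
    by apply: cont_v sP; apply: (holo_rect_v gh); rewrite lexx xw.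
  have := near x s; rewrite lexx xw => /(_ isT sP).
  have := near (x + w) s; rewrite lexx xw => /(_ isT sP).
  move=> /(le_trans (Re_le_normc _)) + /(le_trans (Re_le_normc _)).
  rewrite !ReImE /= !ler_norml; lra.
rewrite !ler_norml !(addrC x w) !(addrC y h) !addrK.
move=> /andP[a1 a2] /andP[a3 a4]; apply/andP; split; lra.
Qed.

(** Halving both sides divides e (w + h)^2 by 4, so the bounds of the four quarters add up exactly
    to that of the whole. *)
Lemma quarter_sum (e w h I1 I2 I3 I4 : R) :
  `|I1| <= e * (w / 2 + h / 2) ^+ 2 -> `|I2| <= e * (w / 2 + h / 2) ^+ 2 ->
  `|I3| <= e * (w / 2 + h / 2) ^+ 2 -> `|I4| <= e * (w / 2 + h / 2) ^+ 2 ->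
  `|I1 + I3 + (I2 + I4)| <= e * (w + h) ^+ 2.
Proof.
have -> : e * (w + h) ^+ 2 = 4 * (e * (w / 2 + h / 2) ^+ 2) by field.
set K := e * _; rewrite !ler_norml.
move=> /andP[a1 b1] /andP[a2 b2] /andP[a3 b3] /andP[a4 b4].
by apply/andP; split; lra.
Qed.

Lemma rect_int_quarter g e x y w h : 0 <= w -> 0 <= h ->
  holo_rect g x (x + w) y (y + h) ->
  let small x y w h := `|rect_int g x (x + w) y (y + h)| <= e * (w + h) ^+ 2 in
  small x y (w / 2) (h / 2) -> small (x + w / 2) y (w / 2) (h / 2) ->
  small x (y + h / 2) (w / 2) (h / 2) ->
  small (x + w / 2) (y + h / 2) (w / 2) (h / 2) -> small x y w h.
Proof.
move=> w0 h0 H small; rewrite /small {small}.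
have w2 : 0 <= w / 2 by rewrite divr_ge0.
have h2 : 0 <= h / 2 by rewrite divr_ge0.
have Ew : x + w / 2 + w / 2 = x + w by rewrite -addrA -splitr.
have Eh : y + h / 2 + h / 2 = y + h by rewrite -addrA -splitr.
have xm : x <= x + w / 2 by rewrite lerDl.
have mx : x + w / 2 <= x + w by rewrite -Ew lerDl.
have ym : y <= y + h / 2 by rewrite lerDl.
have my : y + h / 2 <= y + h by rewrite -Eh lerDl.
have xx : x <= x + w by rewrite lerDl.
have yy : y <= y + h by rewrite lerDl.
have hy t : y <= t <= y + h -> holo_h g x (x + w) t by exact: holo_rect_h.
have vx s : x <= s <= x + w -> holo_v g y (y + h) s by exact: holo_rect_v.
have hl t : y <= t <= y + h -> holo_h g x (x + w / 2) t.
  by move=> tP s /andP[s1 s2]; apply: hy => //; rewrite s1 (le_trans s2).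
have hr t : y <= t <= y + h -> holo_h g (x + w / 2) (x + w) t.
  by move=> tP s /andP[s1 s2]; apply: hy => //; rewrite s2 (le_trans xm).
rewrite Ew Eh (@rect_int_splitx g x (x + w / 2) (x + w) y (y + h));
  try by [|apply: hy; rewrite lexx|apply: vx; rewrite lexx|apply: hy; rewrite
    lexx andbT|apply: vx; rewrite lexx andbT|apply: vx; rewrite xm|rewrite xm].
rewrite (@rect_int_splity g x (x + w / 2) y (y + h / 2) (y + h));
  try by [|apply: hl; rewrite lexx|apply: hl; rewrite lexx andbT
   |apply: hl; rewrite ym|apply: vx; rewrite lexx|apply: vx; rewrite xm
   |rewrite ym].
rewrite (@rect_int_splity g (x + w / 2) (x + w) y (y + h / 2) (y + h));
  try by [|apply: hr; rewrite lexx|apply: hr; rewrite lexx andbT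
   |apply: hr; rewrite ym|apply: vx; rewrite xm
   |apply: vx; rewrite lexx andbT|rewrite ym].
exact: quarter_sum.
Qed.

(** The bound e (w + h)^2 holds for small rectangles around each point and passes from the quarters
    to the whole, so bisection gives it for the full rectangle; [e] is arbitrary. *)
Theorem goursat g a b c d : a <= b -> c <= d -> holo_rect g a b c d ->
  rect_int g a b c d = 0.
Proof.
move=> ab cd gh; apply/eqP; rewrite -normr_le0; apply/ler_addgt0Pr => e' e'0.
rewrite add0r.
have [e e0 eS] : exists2 e, 0 < e & e * (b - a + (d - c)) ^+ 2 <= e'.
  have S0 : 0 < (b - a + (d - c)) ^+ 2 + 1 by rewrite ltr_wpDl// sqr_ge0.
  exists (e' / ((b - a + (d - c)) ^+ 2 + 1)); first by rewrite divr_gt0.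
  by rewrite mulrAC ler_pdivrMr// ler_pM2l// lerDl.
apply: le_trans eS.
have E s t : s + (t - s) = t :> R by rewrite addrC subrK.
have ba : 0 <= b - a by rewrite subr_ge0.
have dc : 0 <= d - c by rewrite subr_ge0.
have sub x y w h : a <= x -> x + w <= a + (b - a) -> c <= y ->
   y + h <= c + (d - c) -> holo_rect g x (x + w) y (y + h).
  rewrite !E => ax xb cy yd s t /andP[s1 s2] /andP[t1 t2]; apply: gh.
    by rewrite (le_trans ax)//= (le_trans s2).
  by rewrite (le_trans cy)//= (le_trans t2).
have := @rectangle_bisection R (fun x y w h =>
  `|rect_int g x (x + w) y (y + h)| <= e * (w + h) ^+ 2) a c _ _ ba dc.
rewrite /= [X in `|rect_int _ _ X _ _|]E [X in `|rect_int _ _ _ _ X|]E; apply.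
- move=> x y w h w0 h0 xa xw yc yh.
  exact: (rect_int_quarter w0 h0 (sub _ _ _ _ xa xw yc yh)).
- move=> p q pP qP.
  have gpq : holo g (p +i* q) by apply: gh; rewrite -1?(E a b) -1?(E c d).
  have [d' d'0 d'P] := rect_int_local e0 gpq.
  exists d' => // x y w h xa xw yc yh xp yq wd hd.
  exact: (d'P x y w h xp yq wd hd (sub x y w h xa xw yc yh)).
Qed.

Lemma itv_shrink (k e x lo hi : R) : 0 < e -> e < k -> k <= x - lo ->
  k <= hi - x ->
  [/\ lo <= x - e, x - e <= hi, lo <= x + e & x + e <= hi] /\ x - e <= x + e.
Proof. by move=> *; split; [split|]; lra. Qed.

(** Cut out a square of half-side e around the puncture: the four rectangles surrounding it
    contribute 0 by [goursat], and the integral over the square is at most a constant times M e. *)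
Lemma goursat_puncture g a b c d p q M r : a < p < b -> c < q < d -> 0 < r ->
  (forall x y, a <= x <= b -> c <= y <= d -> (x != p) || (y != q) ->
     holo g (x +i* y)) ->
  (forall z, z != p +i* q -> normc (z - (p +i* q)) < r -> normc (g z) <= M) ->
  rect_int g a b c d = 0.
Proof.
move=> /andP[ap pb] /andP[cq qd] r0 gh gM.
have M0 : 0 <= M.
  apply: le_trans (gM ((p + r / 2) +i* q) _ _); first exact: normc_ge0.
    by rewrite eq_complex /= negb_and gt_eqF// ltrDl divr_gt0.
  apply: le_lt_trans (normc_le_ReIm _) _; rewrite /= subrr normr0 addr0.
  rewrite addrAC subrr add0r gtr0_norm ?divr_gt0//.
  by rewrite ltr_pdivrMr// ltr_pMr// ltr1n.
apply/eqP; rewrite -normr_le0; apply/ler_addgt0Pr => e' e'0; rewrite add0r.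
pose k := Num.min (Num.min (p - a) (b - p)) (Num.min (q - c) (d - q)).
have k0 : 0 < k by rewrite /k !lt_min !subr_gt0 ap pb cq qd.
(* [ek] keeps the square inside the rectangle; [er] keeps it in the disc where [g] is bounded, its
   points being within 2 e of the puncture; [eM] bounds the quantity that [rect_int_bound] gives for
   the square. *)
have [e e0 [ek er eM]] : exists2 e, 0 < e &
    [/\ e < k, e + e < r & 2 * M * (e + e + (e + e)) <= e'].
  pose e := Num.min (Num.min (k / 2) (r / 4)) (e' / (8 * (M + 1))).
  have M1 : 0 < 8 * (M + 1) by rewrite mulr_gt0// ltr_wpDl.
  have e0 : 0 < e by rewrite /e !lt_min !divr_gt0.
  exists e => //; have [e1 e2 e3] :
    [/\ e <= k / 2, e <= r / 4 & e <= e' / (8 * (M + 1))].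
    by split; rewrite /e !ge_min lexx ?orbT.
  split; [lra|lra|].
  move: e3; rewrite ler_pdivlMr// => e3; nra.
have [ka kb kc kd] : [/\ k <= p - a, k <= b - p, k <= q - c & k <= d - q].
  by split; rewrite /k !ge_min lexx ?orbT.
have hy a' b' t : a <= a' -> b' <= b -> c <= t <= d -> t != q ->
  holo_h g a' b' t.
  move=> aa bb tP tq x /andP[x1 x2]; apply: gh => //; last by rewrite tq orbT.
  by rewrite (le_trans aa)// (le_trans x2).
have vx c' d' s : c <= c' -> d' <= d -> a <= s <= b -> s != p ->
  holo_v g c' d' s.
  move=> cc dd sP sp y /andP[x1 x2]; apply: gh => //; last by rewrite sp.
  by rewrite (le_trans cc)// (le_trans x2).
have pm : p - e != p by rewrite lt_eqF// ltrBlDr ltrDl.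
have pM : p + e != p by rewrite gt_eqF// ltrDl.
have qm : q - e != q by rewrite lt_eqF// ltrBlDr ltrDl.
have qM : q + e != q by rewrite gt_eqF// ltrDl.
have aq : a != p by rewrite lt_eqF.
have bq : b != p by rewrite gt_eqF.
have cq' : c != q by rewrite lt_eqF.
have dq : d != q by rewrite gt_eqF.
have hole a' b' c' d' : a <= a' -> b' <= b -> c <= c' -> d' <= d ->
    (forall x y, a' <= x <= b' -> c' <= y <= d' -> (x != p) || (y != q)) ->
    holo_rect g a' b' c' d'.
  move=> aa bb cc dd H x y xP yP; apply: gh (H _ _ xP yP).
    by case/andP: xP => x1 x2; rewrite (le_trans aa)// (le_trans x2).
  by case/andP: yP => x1 x2; rewrite (le_trans cc)// (le_trans x2).
have [[a1 a2 a3 a4] pp] := itv_shrink e0 ek ka kb.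
have [[c1 c2 c3 c4] qq] := itv_shrink e0 ek kc kd.
have ab : a <= b by rewrite ltW// (lt_trans ap).
have cd : c <= d by rewrite ltW// (lt_trans cq).
have la := lexx a; have lb := lexx b; have lc := lexx c; have ld := lexx d.
have cP : c <= c <= d by rewrite lc cd.
have dP : c <= d <= d by rewrite ld cd.
have aP : a <= a <= b by rewrite la ab.
have bP : a <= b <= b by rewrite lb ab.
have pmP : a <= p - e <= b by rewrite a1 a2.
have pMP : a <= p + e <= b by rewrite a3 a4.
have qmP : c <= q - e <= d by rewrite c1 c2.
have qMP : c <= q + e <= d by rewrite c3 c4.
have ppP : p - e <= p + e <= b by rewrite pp a4.
have qqP : q - e <= q + e <= d by rewrite qq c4.
rewrite (rect_int_splitx pmP cd (hy _ _ _ la lb cP cq') (hy _ _ _ la lb dP dq)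
  (vx _ _ _ lc ld aP aq) (vx _ _ _ lc ld pmP pm) (vx _ _ _ lc ld bP bq)).
rewrite (rect_int_splitx ppP cd (hy _ _ _ a1 lb cP cq') (hy _ _ _ a1 lb dP dq)
  (vx _ _ _ lc ld pmP pm) (vx _ _ _ lc ld pMP pM) (vx _ _ _ lc ld bP bq)).
have left0 : rect_int g a (p - e) c d = 0.
  apply: (goursat a1 cd); apply: (hole _ _ _ _ la a2 lc ld).
  move=> x y /andP[x1 x2] _; rewrite lt_eqF//.
  by apply: le_lt_trans x2 _; rewrite ltrBlDr ltrDl.
have right0 : rect_int g (p + e) b c d = 0.
  apply: (goursat a4 cd); apply: (hole _ _ _ _ a3 lb lc ld).
  move=> x y /andP[x1 x2] _; rewrite gt_eqF//.
  by apply: lt_le_trans x1; rewrite ltrDl.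
rewrite left0 right0.
rewrite (rect_int_splity pp qmP (hy _ _ _ a1 a4 cP cq') (hy _ _ _ a1 a4 qmP qm)
  (hy _ _ _ a1 a4 dP dq) (vx _ _ _ lc ld pmP pm) (vx _ _ _ lc ld pMP pM)).
rewrite (rect_int_splity pp qqP (hy _ _ _ a1 a4 qmP qm) (hy _ _ _ a1 a4 qMP qM)
  (hy _ _ _ a1 a4 dP dq) (vx _ _ _ c1 ld pmP pm) (vx _ _ _ c1 ld pMP pM)).
have low0 : rect_int g (p - e) (p + e) c (q - e) = 0.
  apply: (goursat pp c1); apply: (hole _ _ _ _ a1 a4 lc c2).
  move=> x y _ /andP[x1 x2]; apply/orP; right; rewrite lt_eqF//.
  by apply: le_lt_trans x2 _; rewrite ltrBlDr ltrDl.
have up0 : rect_int g (p - e) (p + e) (q + e) d = 0.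
  apply: (goursat pp c4); apply: (hole _ _ _ _ a1 a4 c3 ld).
  move=> x y _ /andP[x1 x2]; apply/orP; right; rewrite gt_eqF//.
  by apply: lt_le_trans x1; rewrite ltrDl.
rewrite low0 up0.
rewrite !add0r !addr0; apply: le_trans eM.
have gM' s t : (s != p) || (t != q) -> `|s - p| <= e -> `|t - q| <= e ->
    normc (g (s +i* t)) <= M.
  move=> st sp tq; apply: gM; first by rewrite eq_complex negb_and.
  apply: le_lt_trans (normc_le_ReIm _) _; apply: le_lt_trans er.
  exact: lerD.
have E (u : R) : u + e - (u - e) = e + e by rewrite opprB addrC addrA subrK.
rewrite -{1}(E p) -(E q).
have ne : `|p - e - p| <= e by rewrite addrAC subrr add0r normrN gtr0_norm.
have pe : `|p + e - p| <= e by rewrite addrAC subrr add0r gtr0_norm.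
have nq : `|q - e - q| <= e by rewrite addrAC subrr add0r normrN gtr0_norm.
have pq : `|q + e - q| <= e by rewrite addrAC subrr add0r gtr0_norm.
apply: (rect_int_bound pp qq (hy _ _ _ a1 a4 qmP qm) (hy _ _ _ a1 a4 qMP qM)
  (vx _ _ _ c1 c4 pmP pm) (vx _ _ _ c1 c4 pMP pM)).
- move=> s sP; have se : `|s - p| <= e by rewrite ler_distl.
  by split; apply: gM' => //; rewrite ?qm ?qM orbT.
- move=> s sP; have se : `|s - q| <= e by rewrite ler_distl.
  by split; apply: gM' => //; rewrite ?pm ?pM.
Qed.

End Goursat.

(** * Moving a line of integration *)

Section Measurability.
Context {R : realType}.
Local Notation C := R[i].
Local Notation mu := (@lebesgue_measure R).
Implicit Types (g : C -> C).

(** An open set of the plane is the union of the rational boxes it contains; these are countably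
    many, and each is measurable for the product structure on which Tonelli's theorem is applied. *)
Lemma open_measurable2 (A : set (R * R)) :
  (forall p, A p -> exists2 e, 0 < e &
     forall q, `|q.1 - p.1| < e -> `|q.2 - p.2| < e -> A q) ->
  measurable (A : set (measurableTypeR R * measurableTypeR R)).
Proof.
move=> Ao.
pose box (i : (rat * rat) * (rat * rat)) : set (R * R) :=
  [set` `](ratr i.1.1 : R), ratr i.1.2[] `*`
  [set` `](ratr i.2.1 : R), ratr i.2.2[].
pose F i := if pselect (box i `<=` A) then box i else set0.
have -> : A = \bigcup_i F i.
  apply/seteqP; split => [[x y] Axy|p [i _]]; last first.
    by rewrite /F; case: pselect => // sub; exact: sub.
  have [e e0 /= eA] := Ao _ Axy.
  have q_btw (u v : R) : u < v -> exists q : rat, u < ratr q < v.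
    by move=> /rat_in_itvoo[q]; rewrite in_itv /= => uv; exists q.
  have [a /andP[a1 a2]] : exists q : rat, x - e < ratr q < x.
    by apply: q_btw; rewrite ltrBlDr ltrDl.
  have [b /andP[b1 b2]] : exists q : rat, x < ratr q < x + e.
    by apply: q_btw; rewrite ltrDl.
  have [c /andP[c1 c2]] : exists q : rat, y - e < ratr q < y.
    by apply: q_btw; rewrite ltrBlDr ltrDl.
  have [d /andP[d1 d2]] : exists q : rat, y < ratr q < y + e.
    by apply: q_btw; rewrite ltrDl.
  exists ((a, b), (c, d)) => //; rewrite /F; case: pselect => [sub|nsub].
    by split; rewrite /= in_itv /= ?a2 ?b1 ?c2 ?d1.
  exfalso; apply: nsub => -[s t] [] /=;
    rewrite !in_itv /= => /andP[s1 s2] /andP[t1 t2].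
  by apply: eA; rewrite /= ltr_norml; apply/andP; split; lra.
apply: countable_bigcupT_measurable; first exact: countableP.
move=> i; rewrite /F.
case: pselect => [sub|nsub]; last exact: measurable0.
exact: (@measurableX _ _ (measurableTypeR R) (measurableTypeR R) _ _
  (measurable_itv _) (measurable_itv _)).
Qed.

Lemma measurable_normc2 g (U : set (R * R)) :
  (forall x y, U (x, y) -> holo g (x +i* y)) ->
  (forall p, U p -> exists2 e, 0 < e &
     forall q, `|q.1 - p.1| < e -> `|q.2 - p.2| < e -> U q) ->
  measurable_fun (U : set (measurableTypeR R * measurableTypeR R))
    (fun z => (normc (g (z.1 +i* z.2)))).
Proof.
move=> gh Uo mU; apply: (measurability _ (RGenOInfty.measurableE R)) => //.
move=> _ [_ [c ->] <-]; rewrite preimage_itvoy.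
apply: open_measurable2 => -[x y] [/= Uxy cg].
have [e e0 eU] := Uo _ Uxy.
have cg' : 0 < normc (g (x +i* y)) - c.
  by rewrite subr_gt0.
have [d d0 dP] := holo_cont (gh _ _ Uxy) cg'.
exists (Num.min e (d / 2)); first by rewrite lt_min e0 divr_gt0.
move=> [s t] /=; rewrite !lt_min => /andP[se sd] /andP[te td].
split; first exact: eU.
have := dP (s +i* t).
have -> : normc (s +i* t - x +i* y) < d.
  by apply: le_lt_trans (normc_le_ReIm _) _; rewrite /=; lra.
move=> /(_ isT) gd /=.
have : normc (g (x +i* y)) <= normc (g (s +i* t)) +
  normc (g (s +i* t) - g (x +i* y)).
  have {1}-> : g (x +i* y) = g (s +i* t) + - (g (s +i* t) - g (x +i* y)).
    by rewrite opprB addrC subrK.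
  by apply: le_trans (le_normcD _ _) _; rewrite normcN.
lra.
Qed.

End Measurability.

(** * Smallness near the ends of a vertical strip *)

Section Tails.
Context {R : realType}.
Local Notation C := R[i].
Local Notation mu := (@lebesgue_measure R).
Implicit Types (g : C -> C).

(** If all heights in [A] had horizontal integral at least d, the double integral over the strip
    would be at least d mu(A), which is infinite, whereas integrating along the vertical lines
    bounds it by K (x2 - x1). The margins x0 and x3 provide an open set on which the integrand is
    continuous, hence measurable. *)
Lemma edge_small g (x0 x1 x2 x3 T K d : R) (A : set R) :
  x0 < x1 -> x1 <= x2 -> x2 < x3 ->
  (forall x y, x0 < x < x3 -> T < `|y| -> holo g (x +i* y)) ->
  (forall x, x1 <= x <= x2 ->
    (\int[mu]_(y in [set y | (T < `|y|)%R])
      (normc (g (x +i* y)))%:E <= K%:E)%E) ->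
  measurable A -> A `<=` [set y | T < `|y|] -> mu A = +oo%E -> 0 < d ->
  exists2 t, A t &
    (\int[mu]_(x in `[x1, x2]) (normc (g (x +i* t)))%:E < d%:E)%E.
Proof.
move=> x01 x12 x23 gh gK mA AT muA d0; apply: contrapT => noT.
have H t : A t ->
    (d%:E <= \int[mu]_(x in `[x1, x2]) (normc (g (x +i* t)))%:E)%E.
  by move=> At; rewrite leNgt; apply/negP => lt; apply: noT; exists t.
pose TS : set R := [set y | T < `|y|].
have TSo p : TS p -> exists2 e, 0 < e & forall q, `|q - p| < e -> TS q.
  rewrite /TS /= => Tp; exists (`|p| - T); first by rewrite subr_gt0.
  move=> q qp; have := lerB_dist p q; rewrite distrC; lra.
have mTS : measurable TS.
  apply: open_measurable; rewrite openE => p /TSo[e e0 eP]; exists e => //= q.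
  by rewrite /= distrC; exact: eP.
pose U : set (R * R) := [set z | x0 < z.1 < x3 /\ TS z.2].
pose D : set (measurableTypeR R * measurableTypeR R) :=
  `[x1, x2]%classic `*` TS.
have mD : measurable D by apply: measurableX => //; exact: measurable_itv.
have Uo p : U p -> exists2 e, 0 < e &
    forall q, `|q.1 - p.1| < e -> `|q.2 - p.2| < e -> U q.
  move=> [/andP[p1 p2] /TSo[e e0 eP]].
  exists (Num.min e (Num.min (p.1 - x0) (x3 - p.1))).
    by rewrite !lt_min e0 !subr_gt0 p1 p2.
  move=> q; rewrite !lt_min => /andP[_ /andP[q1 q2]] /andP[q3 _].
  split; last exact: eP.
  by move: q1 q2; rewrite !ltr_norml => /andP[? ?] /andP[? ?]; apply/andP;
    split; lra.
have mU : measurable (U : set (measurableTypeR R * measurableTypeR R)).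
  exact: open_measurable2.
pose f (z : measurableTypeR R * measurableTypeR R) := normc (g (z.1 +i* z.2)).
have mf : measurable_fun D f.
  apply: (@measurable_funS _ _ _ _ U) => //.
    move=> [x y] [/=]; rewrite in_itv /= => /andP[a1 a2] Ty; split => //=.
    by rewrite (lt_le_trans x01)//= (le_lt_trans a2).
  by apply: measurable_normc2 => // x y [/= xP yP]; exact: gh.
pose F : measurableTypeR R * measurableTypeR R -> \bar R := (EFin \o f) \_ D.
have mF : measurable_fun setT F.
  by apply/(measurable_restrictT _ mD); exact/measurable_EFinP.
have F0 z : (0 <= F z)%E.
  by apply: erestrict_ge0 => ? _; rewrite lee_fin normc_ge0.
have FE x y : F (x, y) = if (x1 <= x <= x2) && (T < `|y|)
    then (normc (g (x +i* y)))%:E else 0%E.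
  rewrite /F patchE; congr (if _ then _ else _).
  apply/idP/idP.
    by rewrite inE => -[/=]; rewrite in_itv /= => -> ->.
  by move=> /andP[? ?]; rewrite inE; split; rewrite /= ?in_itv.
have := fubini_tonelli (m1 := mu) (m2 := mu) _ mF F0 => FT.
pose G y := (\int[mu]_x F (x, y))%E.
have mG : measurable_fun setT G by exact: measurable_fun_fubini_tonelli_G.
have mH : measurable_fun setT (fun x => \int[mu]_y F (x, y))%E.
  exact: measurable_fun_fubini_tonelli_F.
have mx12 : measurable (`[x1, x2]%classic : set R) by exact: measurable_itv.
have leL : (\int[mu]_x \int[mu]_y F (x, y) <=
            \int[mu]_(x in `[x1, x2]) K%:E)%E.
  rewrite [leRHS]integral_mkcond; apply: ge0_le_integral.
  - exact: measurableT.
  - by move=> x _; apply: integral_ge0.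
  - exact: mH.
  - apply/(measurable_restrictT _ mx12); exact: measurable_cst.
  - move=> x _; rewrite patchE mem_setE; case: ifPn; rewrite in_itv /=.
      move=> xP; apply: le_trans (gK _ xP); rewrite [leRHS]integral_mkcond.
      rewrite le_eqVlt; apply/orP; left; apply/eqP; apply: eq_integral => y _.
      by rewrite FE xP patchE mem_setE.
    move=> /negbTE xP; rewrite integral0_eq; first exact: lexx.
    by move=> y _; rewrite FE xP.
have geR : (\int[mu]_(y in A) d%:E <= \int[mu]_y G y)%E.
  apply: (@le_trans _ _ (\int[mu]_(y in A) G y)%E).
    apply: ge0_le_integral.
    - exact: mA.
    - by move=> y _; rewrite lee_fin ltW.
    - exact: measurable_cst.
    - exact: (measurable_funS measurableT (@subsetT _ A) mG).
    - move=> y Ay; apply: le_trans (H y Ay) _; rewrite [leLHS]integral_mkcond.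
      rewrite le_eqVlt; apply/orP; left; apply/eqP; apply: eq_integral => x _.
      have Ty : T < `|y| by exact: AT.
      by rewrite FE Ty andbT patchE mem_setE in_itv.
  apply: ge0_subset_integral.
  - exact: mA.
  - exact: measurableT.
  - exact: mG.
  - by move=> y _; apply: integral_ge0.
  - exact: subsetT.
have e1 : (\int[mu]_(y in A) d%:E = +oo)%E.
  transitivity (d%:E * mu A)%E; first exact: (integral_cst mu mA d%:E).
  by rewrite muA mulry (gtr0_sg d0) mul1e.
have e2 : (\int[mu]_(x in `[x1, x2]) K%:E < +oo)%E.
  have -> : (\int[mu]_(x in `[x1, x2]) K%:E = K%:E * mu `[x1, x2]%classic)%E.
    exact: (integral_cst mu mx12 K%:E).
  rewrite lebesgue_measure_itv /=.
  by case: ifP => _; rewrite -?EFinB -?EFinM ?mule0 ltry.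
have := le_lt_trans (le_trans geR (le_trans _ leL)) e2.
by rewrite FT lexx e1 ltxx => /(_ isT).
Qed.

(** The two ends vary independently because the heights found above and below by [edge_small] are
    unrelated. The integral of |f| outside one symmetric interval controls all of them. *)
Lemma integral_tail_small (f : R -> R) (e : R) : 0 < e ->
  mu.-integrable setT (EFin \o f) ->
  exists2 T, 0 < T & forall s t, s < - T -> T < t ->
    `|\int[mu]_(x in `[s, t]) f x - \int[mu]_x f x| <= e.
Proof.
move=> e0 fi.
have fiS (A : set R) : measurable A -> mu.-integrable A (EFin \o f).
  by move=> mA; apply: integrableS fi.
pose F (n : nat) : set R := [set` `[- n%:R, n%:R]].
have mF n : measurable (F n) by exact: measurable_itv.
have ndF : nondecreasing_seq F.
  move=> m n mn; apply/subsetPset => x; rewrite /F /= !in_itv /=.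
  have : (m%:R <= n%:R :> R) by rewrite ler_nat.
  by move=> ? /andP[? ?]; apply/andP; split; lra.
have FT : \bigcup_i F i = setT.
  apply/seteqP; split => // x _; exists (Num.bound `|x|) => //.
  have := archi_boundP (normr_ge0 x); rewrite /F /= in_itv /= => h.
  by rewrite -ler_norml ltW.
have afi : mu.-integrable setT (fun x => `|f x|%:E).
  exact: integrable_norm.
have cvgI : (\int[mu]_(x in F i) `|f x|%:E)%E @[i --> \oo] -->
    (\int[mu]_x `|f x|%:E)%E.
  rewrite -FT; apply: ge0_nondecreasing_set_cvg_integral => //.
  by move=> i; apply: (measurable_funS measurableT) => //;
    exact: measurable_int afi.
have afS (A : set R) : measurable A ->
  mu.-integrable A (EFin \o (fun x => `|f x|)).
  by move=> mA; apply: integrableS afi.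
have {}cvgI : \int[mu]_(x in F i) `|f x| @[i --> \oo] --> \int[mu]_x `|f x|.
  apply: fine_cvg; rewrite fineK//.
  exact: (integrable_fin_num measurableT afi).
have /cvgrPdist_le /(_ e e0) [n _ nP] := cvgI.
(* The summand 1 makes the threshold positive even when n = 0. *)
exists (n%:R + 1); first by rewrite ltr_wpDl.
move=> s t sT tT.
have mst : measurable (`[s, t]%classic : set R) by exact: measurable_itv.
have splitT h : mu.-integrable setT (EFin \o h) ->
  forall A : set R, measurable A ->
    \int[mu]_x h x = \int[mu]_(x in A) h x + \int[mu]_(x in ~` A) h x.
  move=> hi A mA; rewrite -Rintegral_setU ?setUv//; first exact: measurableC.
  by apply/disj_setPS => x [].
have mCF : measurable (~` F n) by exact: measurableC.
rewrite (splitT f fi _ mst) opprD addNKr normrN.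
have mC : measurable (~` `[s, t]%classic : set R) by exact: measurableC.
apply: (le_trans (@le_normr_Rintegral _ _ R mu _ f mC (fiS _ mC))).
apply: (@le_trans _ _ (\int[mu]_(x in ~` F n) `|f x|)).
  rewrite /Rintegral fine_le//.
  - by apply: integrable_fin_num => //; exact: afS.
  - by apply: integrable_fin_num => //; exact: afS.
  - apply: ge0_subset_integral => //.
      by apply: (measurable_funS measurableT) => //; exact: measurable_int afi.
    apply: subsetC => x; rewrite /F /= !in_itv /= => /andP[? ?].
    by apply/andP; split; lra.
have := nP n (leqnn n); rewrite (splitT _ afi _ (mF n)) /=.
by rewrite addrC addKr => /(le_trans (ler_norm _)).
Qed.

End Tails.

(** * Equality of the integrals along two vertical lines *)

Section VerticalLines.
Context {R : realType}.
Local Notation C := R[i].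
Local Notation mu := (@lebesgue_measure R).
Implicit Types (g : C -> C).

Lemma normc_sub_le (z w : C) : `|normc z - normc w| <= normc (z - w).
Proof.
have H (u v : C) : normc u - normc v <= normc (u - v).
  by rewrite lerBlDr -{1}(subrK v u) le_normcD.
by rewrite ler_norml H andbT lerNl opprB normcB H.
Qed.

Lemma normc_cont_h g x y : holo g (x +i* y) ->
  {for x, continuous (fun t => normc (g (t +i* y)))}.
Proof.
move=> /holo_cont gz; apply: (proj2 (continuousP_dist _ _)) => e e0.
have [d d0 dP] := gz e e0; exists d => // t td.
apply: le_lt_trans (normc_sub_le _ _) _; apply: dP.
by apply: le_lt_trans (normc_le_ReIm _) _; rewrite /= subrr normr0 addr0.
Qed.

Lemma mu_integrableD (A : set R) (f h : R -> R) : measurable A ->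
  mu.-integrable A (EFin \o f) -> mu.-integrable A (EFin \o h) ->
  mu.-integrable A (EFin \o (fun x => f x + h x)).
Proof. by move=> mA fi hi; exact: (@integrableD _ _ R mu A mA _ _ fi hi). Qed.

Lemma mu_integrableB (A : set R) (f h : R -> R) : measurable A ->
  mu.-integrable A (EFin \o f) -> mu.-integrable A (EFin \o h) ->
  mu.-integrable A (EFin \o (fun x => f x - h x)).
Proof. by move=> mA fi hi; exact: (@integrableB _ _ R mu A mA _ _ fi hi). Qed.

Lemma edge_bound g x1 x2 s t d : x1 <= x2 ->
  holo_h g x1 x2 s -> holo_h g x1 x2 t ->
  (\int[mu]_(x in `[x1, x2]) (normc (g (x +i* s)))%:E < d%:E)%E ->
  (\int[mu]_(x in `[x1, x2]) (normc (g (x +i* t)))%:E < d%:E)%E ->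
  `|\int[mu]_(x in `[x1, x2]) (Im (g (x +i* s)) - Im (g (x +i* t)))| <= d + d.
Proof.
move=> x12 hs ht Hs Ht.
have si u : holo_h g x1 x2 u ->
  mu.-integrable `[x1, x2] (EFin \o (fun x => normc (g (x +i* u)))).
  by move=> hu; apply: integrable_seg => // x /hu; exact: normc_cont_h.
have ii : mu.-integrable `[x1, x2]
    (EFin \o (fun x => Im (g (x +i* s)) - Im (g (x +i* t)))).
  by apply: integrable_seg => // x; exact: cont_h.
have mI : measurable (`[x1, x2]%classic : set R) by exact: measurable_itv.
apply: le_trans (@le_normr_Rintegral _ _ R mu _ _ mI ii) _.
apply: (@le_trans _ _ (\int[mu]_(x in `[x1, x2]) (normc (g (x +i* s)) +
  normc (g (x +i* t))))).
  apply: le_Rintegral => //.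
  - exact: integrable_norm ii.
  - exact: mu_integrableD mI (si _ hs) (si _ ht).
  - move=> x _; apply: le_trans (ler_normB _ _) _.
    by apply: lerD; exact: Im_le_normc.
rewrite (@RintegralD _ _ R mu _ _ _ mI (si _ hs) (si _ ht)).
by apply: lerD; rewrite /Rintegral -lee_fin fineK ?ltW//;
  apply: integrable_fin_num => //; exact: si.
Qed.

(** Each long rectangle gives 0; its vertical sides are within e / 3 of the full line integrals, and
    its two horizontal sides, taken at heights from [edge_small], contribute at most 2 e / 3.
    Holomorphy is asked only for |y| > T, and the vanishing on rectangles is a hypothesis, so that a
    removable singularity may lie between the lines. *)
Lemma line_integral_eq g (x0 x1 x2 x3 T K : R) :
  x0 < x1 -> x1 <= x2 -> x2 < x3 ->
  (forall x y, x0 < x < x3 -> T < `|y| -> holo g (x +i* y)) ->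
  (forall s t, s < - T -> T < t -> rect_int g x1 x2 s t = 0) ->
  (forall x, x1 <= x <= x2 ->
    (\int[mu]_(y in [set y | (T < `|y|)%R])
      (normc (g (x +i* y)))%:E <= K%:E)%E) ->
  mu.-integrable setT (EFin \o (fun y => Re (g (x1 +i* y)))) ->
  mu.-integrable setT (EFin \o (fun y => Re (g (x2 +i* y)))) ->
  \int[mu]_y Re (g (x1 +i* y)) = \int[mu]_y Re (g (x2 +i* y)).
Proof.
move=> x01 x12 x23 gh rect0 gK i1 i2.
apply/esym/eqP; rewrite -subr_eq0 -normr_le0; apply/ler_addgt0Pr => e e0.
rewrite add0r -(@RintegralB _ _ R mu _ _ _ measurableT i2 i1).
set f := fun y => Re (g (x2 +i* y)) - Re (g (x1 +i* y)).
have fi : mu.-integrable setT (EFin \o f).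
  exact: mu_integrableB measurableT i2 i1.
have e3 : 0 < e / 3 by rewrite divr_gt0.
have [T1 T10 T1P] := integral_tail_small e3 fi.
pose T2 := Num.max T T1.
have TT2 : T <= T2 by rewrite le_max lexx.
have TT1 : T1 <= T2 by rewrite le_max lexx orbT.
have [t] : exists2 t, [set` `]T2, +oo[] t &
    (\int[mu]_(x in `[x1, x2]) (normc (g (x +i* t)))%:E < (e / 3)%:E)%E.
  apply: (edge_small x01 x12 x23 gh gK) => //.
    move=> y; rewrite /= in_itv /= andbT => yT.
    by rewrite (lt_le_trans _ (ler_norm _))// (le_lt_trans TT2).
  by rewrite lebesgue_measure_itv /= ?ltry ?ltNyr.
rewrite /= in_itv /= andbT => tT Ht.
have [s] : exists2 s, [set` `]-oo, (- T2)[] s &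
    (\int[mu]_(x in `[x1, x2]) (normc (g (x +i* s)))%:E < (e / 3)%:E)%E.
  apply: (edge_small x01 x12 x23 gh gK) => //.
    move=> y; rewrite /= in_itv /= ltrNr => yT.
    by rewrite -normrN (lt_le_trans _ (ler_norm _))// (le_lt_trans TT2).
  by rewrite lebesgue_measure_itv /= ?ltry ?ltNyr.
rewrite /= in_itv /= => sT Hs.
have h u : T < `|u| -> holo_h g x1 x2 u.
  move=> Tu x /andP[? ?]; apply: gh => //.
  by rewrite (lt_le_trans x01)//= (le_lt_trans _ x23).
have hs : holo_h g x1 x2 s.
  by apply: h; rewrite -normrN (lt_le_trans _ (ler_norm _))//; lra.
have ht : holo_h g x1 x2 t.
  by apply: h; rewrite (lt_le_trans _ (ler_norm _))//; lra.
have := edge_bound x12 hs ht Hs Ht.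
have := T1P s t ltac:(lra) ltac:(lra).
have := rect0 s t ltac:(lra) ltac:(lra).
rewrite /rect_int -/f; set I1 := Rintegral _ _ _; set I2 := Rintegral _ _ _.
set I3 := Rintegral _ _ _.
rewrite !ler_norml => H /andP[a1 a2] /andP[a3 a4].
by apply/andP; split; lra.
Qed.

End VerticalLines.

(** * Norms along vertical lines *)

Section LineNorms.
Context {R : realType}.
Local Notation C := R[i].
Local Notation mu := (@lebesgue_measure R).
Implicit Types (f g : C -> C).

Definition sqn f (x y : R) : R := normc (f (x +i* y)) ^+ 2.

Definition line_int f x : R := \int[mu]_y sqn f x y.

Lemma sqn_ge0 f x y : 0 <= sqn f x y. Proof. exact: sqr_ge0. Qed.

Lemma normc_cont_v g x y : holo g (x +i* y) ->
  {for y, continuous (fun t => normc (g (x +i* t)))}.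
Proof.
move=> /holo_cont gz; apply: (proj2 (continuousP_dist _ _)) => e e0.
have [d d0 dP] := gz e e0; exists d => // t td.
apply: le_lt_trans (normc_sub_le _ _) _; apply: dP.
by apply: le_lt_trans (normc_le_ReIm _) _; rewrite /= subrr normr0 add0r.
Qed.

Lemma sqn_cont f x : (forall y, holo f (x +i* y)) -> continuous (sqn f x).
Proof.
move=> fh y; have fc := normc_cont_v (fh y).
exact: (@continuousM _ _ (fun t => normc (f (x +i* t))) _ _ fc fc).
Qed.

Lemma dominated_integrable (h m : R -> R) : continuous h ->
  mu.-integrable setT (EFin \o m) -> (forall y, `|h y| <= m y) ->
  mu.-integrable setT (EFin \o h).
Proof.
move=> hc mi hm; apply: le_integrable mi => //.
  by apply/measurable_EFinP; exact: continuous_measurable_fun.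
move=> y _ /=; rewrite lee_fin (le_trans (hm y))//; exact: ler_norm.
Qed.

Lemma open_abs_gt (T : R) : open [set y : R | T < `|y|].
Proof.
rewrite openE => p /= Tp; exists (`|p| - T) => /=; first by rewrite subr_gt0.
by move=> q /= pq; have := lerB_dist p q; lra.
Qed.

(** This provides the uniform bound that [line_integral_eq] requires on each line of the strip.
    Continuity of [h] is asked only beyond T, which leaves room for a singularity of the
    integrand. *)
Lemma tail_integral_le (T : R) (h m : R -> R) (K : R) :
  (forall y, T < `|y| -> {for y, continuous h}) ->
  mu.-integrable setT (EFin \o m) -> (forall y, 0 <= m y) ->
  (forall y, T < `|y| -> 0 <= h y <= m y) ->
  \int[mu]_y m y <= K ->
  (\int[mu]_(y in [set y | (T < `|y|)%R]) (h y)%:E <= K%:E)%E.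
Proof.
move=> hc mi m0 hm mK; have oA := @open_abs_gt T.
have mA : measurable [set y : R | T < `|y|] by exact: open_measurable.
have mm : measurable_fun setT (EFin \o m) by exact: measurable_int mi.
apply: (@le_trans _ _ (\int[mu]_(y in [set y | (T < `|y|)%R]) (m y)%:E)%E).
  apply: ge0_le_integral => //.
  - by move=> y /hm /andP[h0 _]; rewrite lee_fin.
  - apply/measurable_EFinP; apply: open_continuous_measurable_fun => //.
    by move=> y; rewrite inE; exact: hc.
  - exact: (measurable_funS measurableT (@subsetT _ _) mm).
  - by move=> y /hm /andP[_ ym]; rewrite lee_fin.
apply: (@le_trans _ _ (\int[mu]_y (m y)%:E)%E).
  by apply: ge0_subset_integral => // y _; rewrite lee_fin.
rewrite -[leLHS]fineK ?lee_fin//.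
by apply: integrable_fin_num.
Qed.

Lemma H2_holo f x y : in_H2 f -> 0 < x -> holo f (x +i* y).
Proof. by move=> [fa _] x0; exact: fa. Qed.

Lemma sqn_integrable f x : in_H2 f -> 0 < x ->
  mu.-integrable setT (EFin \o sqn f x).
Proof.
move=> [fa fN] x0; apply/integrableP; split.
  apply/measurable_EFinP; apply: continuous_measurable_fun.
  by apply: sqn_cont => y; exact: fa.
have : (line_sqnorm f x < +oo)%E.
  by apply: le_lt_trans fN; apply: ereal_sup_ubound; exists x.
have -> : (\int[mu]_y `|(EFin \o sqn f x) y| = \int[mu]_y (sqn f x y)%:E)%E.
  by apply: eq_integral => y _; rewrite /= ger0_norm ?sqn_ge0.
rewrite /line_sqnorm; set I := (\int[mu]_(y in _) _)%E.
have : (0 <= I)%E by apply: integral_ge0 => y _; rewrite lee_fin sqr_ge0.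
have pi0 : 0 < pi^-1 :> R by rewrite invr_gt0 pi_gt0.
rewrite /sqn -/I; case: I => [r| |] // _; first by move=> _; exact: ltry.
by rewrite mulry gtr0_sg// mul1e.
Qed.

Lemma line_sqnormE f x : in_H2 f -> 0 < x ->
  line_sqnorm f x = (pi^-1 * line_int f x)%:E.
Proof.
move=> fH x0; rewrite EFinM /line_int /Rintegral fineK//.
by apply: integrable_fin_num => //; exact: sqn_integrable.
Qed.

Lemma line_int_ge0 f x : 0 <= line_int f x.
Proof. by apply: Rintegral_ge0 => y _; exact: sqn_ge0. Qed.

Lemma H2_sqnorm_fin f : in_H2 f -> H2_sqnorm f = (H2_norm f ^+ 2)%:E.
Proof.
move=> fH; have pi0 : 0 <= pi^-1 :> R by rewrite invr_ge0 pi_ge0.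
have : (0 <= H2_sqnorm f)%E.
  apply: (@le_trans _ _ (line_sqnorm f 1)).
    by rewrite line_sqnormE// lee_fin mulr_ge0// line_int_ge0.
  by apply: ereal_sup_ubound; exists 1 => //=.
rewrite /H2_norm; have [_] := fH; case: H2_sqnorm => [r| |] //= _.
by rewrite lee_fin => r0; rewrite sqr_sqrtr.
Qed.

Lemma line_int_le f x : in_H2 f -> 0 < x ->
  pi^-1 * line_int f x <= H2_norm f ^+ 2.
Proof.
move=> fH x0; rewrite -lee_fin -line_sqnormE// -H2_sqnorm_fin//.
by apply: ereal_sup_ubound; exists x.
Qed.

Lemma line_int_bounded f : in_H2 f ->
  exists N, forall x, 0 < x -> line_int f x <= N.
Proof.
move=> fH; exists (pi * H2_norm f ^+ 2) => x x0.
by have := line_int_le fH x0; rewrite mulrC ler_pdivrMr ?pi_gt0// mulrC.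
Qed.

(** This does the work of the Cauchy-Schwarz inequality: a product of two H^2 functions is dominated
    on lines by an integrable half-sum of squares. *)
Lemma normcM_le_sq (z w : C) :
  normc (z * w) <= 2^-1 * (normc z ^+ 2 + normc w ^+ 2).
Proof.
rewrite ComplexField.Normc.normcM; have := sqr_ge0 (normc z - normc w).
by rewrite sqrrB; lra.
Qed.

Lemma sum_sqn_integrable f g s t : in_H2 f -> in_H2 g -> 0 < s -> 0 < t ->
  mu.-integrable setT (EFin \o (fun y => 2^-1 * (sqn f s y + sqn g t y))).
Proof.
move=> fH gH s0 t0; apply:
  (@integrableZl _ _ R mu _ measurableT 2^-1 (fun y =>
    (sqn f s y + sqn g t y)%:E)).
by apply: mu_integrableD => //; exact: sqn_integrable.
Qed.

Lemma int_half_sum f s t : in_H2 f -> 0 < s -> 0 < t ->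
  \int[mu]_y (2^-1 * (sqn f s y + sqn f t y)) =
  2^-1 * (line_int f s + line_int f t).
Proof.
move=> fH s0 t0; have is_ := sqn_integrable fH s0;
  have it := sqn_integrable fH t0.
rewrite (@RintegralZl _ _ R mu setT _ 2^-1 measurableT
  (mu_integrableD measurableT is_ it)).
by rewrite (@RintegralD _ _ R mu setT _ _ measurableT is_ it).
Qed.

(* The reflected function [z |-> conj (f (2 x - conj z))] agrees with [conj f]
   on the line [Re z = x], so moving that line turns the integral of [|f|^2]
   into that of [f (x + d + i y) * conj (f (x - d + i y))]. *)
Lemma line_int_midpoint f x d : in_H2 f -> 0 <= d -> d < x ->
  line_int f x <= 2^-1 * (line_int f (x + d) + line_int f (x - d)).
Proof.
move=> fH d0 dx; have x0 : 0 < x by apply: le_lt_trans dx.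
pose g z := f z * conjc (f ((x + x)%:C - conjc z)).
have gE s y : g (s +i* y) = f (s +i* y) * conjc (f ((x + x - s) +i* y)).
  by rewrite /g; congr (_ * conjc (f _)); apply: ReImP;
    rewrite /= ?opprK ?add0r.
have gh s y : 0 < s < x + x -> holo g (s +i* y).
  move=> /andP[s0 sx]; apply: holoM; first exact: H2_holo.
  apply: holo_reflect.
  have -> : (x + x)%:C - (s +i* y)^* = (x + x - s) +i* y.
    by apply: ReImP; rewrite /= ?opprK ?add0r.
  by apply: H2_holo => //; rewrite subr_gt0.
have g_le s y : normc (g (s +i* y)) <= 2^-1 * (sqn f s y + sqn f (x + x - s) y).
  by rewrite gE; apply: le_trans (normcM_le_sq _ _) _; rewrite normc_conj.
have [N NP] := line_int_bounded fH.
have gi s : 0 < s < x + x ->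
  mu.-integrable setT (EFin \o (fun y => Re (g (s +i* y)))).
  move=> /andP[s0 sx].
  have sx' : 0 < x + x - s by rewrite subr_gt0.
  apply: (dominated_integrable _ (sum_sqn_integrable fH fH s0 sx')).
    by move=> y; apply: Re_cont_v; apply: gh; rewrite s0.
  by move=> y; apply: le_trans (g_le s y); exact: Re_le_normc.
have xx : 0 < x < x + x by rewrite x0 ltrDl.
have xdx : 0 < x + d < x + x by rewrite ltr_wpDr//= ltrD2l.
have xdE : x + x - (x + d) = x - d by rewrite opprD addrA addrK.
have gx y : Re (g (x +i* y)) = sqn f x y.
  rewrite gE addrK /sqn sqr_normcE ReM ReJ ImJ; ring.
have -> : line_int f x = \int[mu]_y Re (g (x +i* y)).
  by apply: eq_Rintegral => y _; rewrite gx.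
have xd : x <= x + d by rewrite lerDl.
have xd2 : x + d < x + x by rewrite ltrD2l.
(* Both factors of [g] are holomorphic for 0 < Re z < 2 x. There is no singularity, so the threshold
   is 0, and the half-sum of two line integrals is at most N. *)
rewrite (@line_integral_eq _ g 0 x (x + d) (x + x) 0 N)//.
- have xd0 : 0 < x - d by rewrite subr_gt0.
  have xpd0 : 0 < x + d by rewrite ltr_wpDr.
  rewrite -int_half_sum//; apply: le_Rintegral => //.
  + exact: gi.
  + exact: sum_sqn_integrable.
  + move=> y _; rewrite -xdE; apply: le_trans (ler_norm _) _.
    exact: le_trans (Re_le_normc _) (g_le _ _).
- by move=> s y sP _; exact: gh.
- move=> s t s0 t0; apply: goursat => //;
    first by rewrite ltW// (lt_trans _ t0)// -oppr0.
  move=> u y /andP[u1 u2] _; apply: gh.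
  by rewrite (lt_le_trans x0)//= (le_lt_trans u2).
- move=> s /andP[s1 s2].
  have s0 : 0 < s by exact: lt_le_trans s1.
  have sx : 0 < x + x - s by rewrite subr_gt0 (le_lt_trans s2).
  apply: (@tail_integral_le 0 _ (fun y =>
    2^-1 * (sqn f s y + sqn f (x + x - s) y))).
  + by move=> y _; apply: normc_cont_v; apply: gh; rewrite s0 -subr_gt0.
  + exact: sum_sqn_integrable.
  + by move=> y; rewrite mulr_ge0// addr_ge0// sqn_ge0.
  + by move=> y _; rewrite normc_ge0 g_le.
  + by rewrite int_half_sum//; have := NP s s0; have := NP _ sx; lra.
- exact: gi.
- exact: gi.
Qed.

End LineNorms.

(** * Monotonicity in the abscissa, the limit at the imaginary axis, and explicit integrals *)

Section BoundaryNorm.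
Context {R : realType}.
Local Notation C := R[i].
Local Notation mu := (@lebesgue_measure R).
Implicit Types (f g : C -> C).

(* A midpoint convex function that is bounded above on a half-line cannot
   increase. *)
Lemma line_int_noninc f a b : in_H2 f -> 0 < a -> a <= b ->
  line_int f b <= line_int f a.
Proof.
move=> fH a0; rewrite le_eqVlt => /predU1P[->//|ab]; rewrite leNgt;
  apply/negP => lt.
set M := line_int f in lt; set d := b - a.
have d0 : 0 < d by rewrite subr_gt0.
pose u (n : nat) := M (a + n%:R * d).
have uS n : 2 * u n.+1 <= u n.+2 + u n.
  have dx : d < a + n.+1%:R * d.
    have nd : 0 <= n%:R * d by apply: mulr_ge0 => //; exact: ltW.
    by rewrite -natr1 mulrDl mul1r; lra.
  have := line_int_midpoint fH (ltW d0) dx; rewrite -/M.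
  have -> : a + n.+1%:R * d + d = a + n.+2%:R * d by rewrite -!natr1; ring.
  have -> : a + n.+1%:R * d - d = a + n%:R * d by rewrite -!natr1; ring.
  rewrite -/(u _) -/(u _) -/(u _); lra.
(* By midpoint convexity the increments of [u] do not decrease, so a positive first increment forces
   linear growth, against the bound N. *)
have step n : u 1%N - u 0%N <= u n.+1 - u n.
  by elim: n => // n IH; have := uS n; lra.
have grow n : n%:R * (u 1%N - u 0%N) <= u n - u 0%N.
  elim: n => [|n IH]; first by rewrite mul0r subrr.
  by rewrite -natr1 mulrDl mul1r; have := step n; lra.
have u1 : u 1%N = M b by rewrite /u mul1r /d addrC subrK.
have u0 : u 0%N = M a by rewrite /u mul0r addr0.
have k0 : 0 < u 1%N - u 0%N by rewrite u1 u0 subr_gt0.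
have [N NP] := line_int_bounded fH.
have := grow (Num.bound ((N - u 0%N) / (u 1%N - u 0%N))).
set n := Num.bound _; have : (N - u 0%N) / (u 1%N - u 0%N) < n%:R.
  apply: archi_boundP; apply: divr_ge0; last exact: ltW.
  by rewrite u0 subr_ge0; exact: NP.
rewrite ltr_pdivrMr// => h1 h2.
have := NP (a + n%:R * d); rewrite -/M -/(u n).
have : 0 < a + n%:R * d by rewrite ltr_wpDr// mulr_ge0// ltW.
by move=> /[swap] /[apply]; lra.
Qed.

Lemma H2_norm_cvg f : in_H2 f ->
  pi^-1 * line_int f x @[x --> 0^'+] --> H2_norm f ^+ 2.
Proof.
move=> fH; apply/cvgrPdist_le => e e0.
have pi0 : 0 < pi^-1 :> R by rewrite invr_gt0 pi_gt0.
have [_ [x x0 <-]] :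
    exists2 l, [set line_sqnorm f x | x in [set x : R | 0 < x]] l &
    ((H2_norm f ^+ 2 - e)%:E < l)%E.
  apply: ereal_sup_gt; rewrite -/(H2_sqnorm f) H2_sqnorm_fin// lte_fin.
  by rewrite ltrBlDr ltrDl.
rewrite line_sqnormE// lte_fin => xP.
near=> t.
have t0 : 0 < t by [].
have tx : t <= x by near: t; exact: nbhs_right_le.
have := line_int_le fH t0; have := line_int_noninc fH t0 tx.
rewrite -(ler_pM2l pi0) => h1 h2; rewrite ler_norml; apply/andP; split; lra.
Unshelve. all: by end_near. Qed.

Lemma is_derive_affine (a b y : R) :
  is_derive y (1 : R) (fun y : R => a * y + b) a.
Proof.
have -> : (fun y : R => a * y + b) = a *: (@id R) + cst b by apply/funext.
by apply: is_derive_eq; rewrite addr0 /GRing.scale /= mulr1.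
Qed.

Lemma continuous_affine (a b : R) : continuous (fun y : R => a * y + b).
Proof.
move=> y; apply/differentiable_continuous/derivable1_diffP.
by have [] := is_derive_affine a b y.
Qed.

Lemma integral_affine (G : R -> R) (a b : R) : 0 < a -> continuous G ->
  (forall y, 0 <= G y) ->
  (\int[mu]_y (G y)%:E = \int[mu]_y (G (a * y + b) * a)%:E)%E.
Proof.
move=> a0 Gc G0; pose F y : R := a * y + b.
have dF y := is_derive_affine a b y.
have FE : derive1 F = cst a.
  by apply/funext => y; rewrite derive1E; exact: derive_val.
rewrite (@increasing_ge0_integration_by_substitutionT R F G) ?FE//.
- by move=> x y xy; rewrite /F ltrD2r ltr_pM2l.
- by move=> x; exact: cst_continuous.
- exact: is_cvg_cst.
- exact: is_cvg_cst.
- apply/cvgrNyPle => M.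
  have := nbhs_ninfty_le (num_real ((M - b) / a)); apply: filterS => y /= yM.
  by rewrite /F -lerBrDr mulrC -ler_pdivlMr.
- apply/cvgryPge => M.
  have := nbhs_pinfty_ge (num_real ((M - b) / a)); apply: filterS => y /= yM.
  by rewrite /F -lerBlDr mulrC -ler_pdivrMr.
Qed.

(** The substitution (y - m) / s reduces this to the integral of 1 / (1 + x^2), which is twice its
    value pi / 2 on the half-line. *)
Lemma integral_poisson (s m : R) : 0 < s ->
  (\int[mu]_y ((s ^+ 2 + (y - m) ^+ 2)^-1)%:E = (pi / s)%:E)%E.
Proof.
move=> s0.
have total : (\int[mu]_x ((oneDsqr x)^-1)%:E = pi%:E)%E.
  rewrite (ge0_symfun_integralT (f := fun x => (oneDsqr x)^-1)).
  - by rewrite -set_itvcy integral0y_oneDsqr -EFinM mulrC divfK.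
  - by move=> x; rewrite invr_ge0 addr_ge0// sqr_ge0.
  - exact: continuous_oneDsqrV.
  - by move=> x; rewrite /= /oneDsqr sqrrN.
rewrite (@integral_affine (fun x => (oneDsqr x)^-1) s^-1 (- m / s)) in total;
  first last.
- by move=> x; rewrite invr_ge0 addr_ge0// sqr_ge0.
- exact: continuous_oneDsqrV.
- by rewrite invr_gt0.
have s'0 : 0 <= s^-1 by rewrite invr_ge0 ltW.
transitivity (s^-1%:E * \int[mu]_y ((oneDsqr (s^-1 * y +
  - m / s))^-1 * s^-1)%:E)%E.
  rewrite -ge0_integralZl//.
  - apply: eq_integral => y _; rewrite -EFinM; congr EFin.
    have D0 : s ^+ 2 + (y - m) ^+ 2 != 0.
      by rewrite gt_eqF// ltr_pwDl ?exprn_gt0 ?sqr_ge0.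
    rewrite /oneDsqr; have sn0 : s != 0 by rewrite gt_eqF.
    have -> : 1 + (s^-1 * y + - m / s) ^+ 2 = (s ^+ 2 + (y - m) ^+ 2) / s ^+ 2.
      by field.
    by field; rewrite sn0 D0.
  - apply/measurable_EFinP; apply: continuous_measurable_fun => y.
    have c1 : {for y, continuous (fun y => (oneDsqr (s^-1 * y + - m / s))^-1)}.
      apply: (@continuous_comp _ _ _ (fun y => s^-1 * y + - m / s)
        (fun x => (oneDsqr x)^-1)); first exact: continuous_affine.
      exact: continuous_oneDsqrV.
    exact: (@continuousM _ _ (fun y => (oneDsqr (s^-1 * y + - m / s))^-1)
      (cst s^-1) _ c1 (@cst_continuous _ _ _ _)).
  - by move=> y _; rewrite lee_fin mulr_ge0// invr_ge0 addr_ge0// sqr_ge0.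
by rewrite total -EFinM mulrC.
Qed.

End BoundaryNorm.

(** * Elements of the Hardy space *)

Section HardySpace.
Context {R : realType}.
Local Notation C := R[i].
Local Notation mu := (@lebesgue_measure R).
Implicit Types (f g : C -> C).

Lemma line_sqnorm_ext f g x : eq_on_Cplus f g -> 0 < x ->
  line_sqnorm f x = line_sqnorm g x.
Proof.
move=> fg x0; rewrite /line_sqnorm; congr (_ * _)%E.
by apply: eq_integral => y _; rewrite fg.
Qed.

Lemma H2_sqnorm_ext f g : eq_on_Cplus f g -> H2_sqnorm f = H2_sqnorm g.
Proof.
move=> fg; congr ereal_sup; apply/seteqP; split => _ [x x0 <-];
  by exists x => //; rewrite (line_sqnorm_ext fg).
Qed.

Lemma H2_norm_ext f g : eq_on_Cplus f g -> H2_norm f = H2_norm g.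
Proof. by move=> fg; rewrite /H2_norm (H2_sqnorm_ext fg). Qed.

Lemma holo_Cplus_ext f g w : eq_on_Cplus f g -> Cplus w -> holo f w -> holo g w.
Proof.
move=> fg w0; apply: (@holo_near _ _ _ _ (Re w)) => // z zw; apply: fg.
have := le_lt_trans (Re_le_normc _) zw; rewrite ReD ReN /Cplus /= ltr_norml.
by move=> /andP[]; lra.
Qed.

Lemma in_H2_ext f g : eq_on_Cplus f g -> in_H2 f -> in_H2 g.
Proof.
move=> fg [fa fN]; split; last by rewrite -(H2_sqnorm_ext fg).
by move=> w w0; apply: (holo_Cplus_ext fg w0); exact: fa.
Qed.

Lemma in_H2_intro f N : (forall x y, 0 < x -> holo f (x +i* y)) ->
  (forall x, 0 < x -> (\int[mu]_y (sqn f x y)%:E <= N%:E)%E) -> in_H2 f.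
Proof.
move=> fh fN; split; first by move=> [x y] w0; exact: fh.
apply: (@le_lt_trans _ _ (pi^-1 * N)%:E); last exact: ltry.
apply: ge_ereal_sup => _ [x x0 <-]; rewrite EFinM; apply: lee_wpmul2l.
  by rewrite lee_fin invr_ge0 pi_ge0.
exact: fN.
Qed.

Lemma H2_norm_le f M : in_H2 f ->
  (forall x, 0 < x -> pi^-1 * line_int f x <= M) -> H2_norm f ^+ 2 <= M.
Proof.
move=> fH fM; rewrite -lee_fin -H2_sqnorm_fin//.
by apply: ge_ereal_sup => _ [x x0 <-]; rewrite line_sqnormE// lee_fin fM.
Qed.

Lemma sqr_normcD_le (z w : C) :
  normc (z + w) ^+ 2 <= 2 * normc z ^+ 2 + 2 * normc w ^+ 2.
Proof.
rewrite !sqr_normcE ReD ImD.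
by have := sqr_ge0 (Re z - Re w); have := sqr_ge0 (Im z - Im w); nra.
Qed.

Lemma in_H2_lin f g (c : C) : in_H2 f -> in_H2 g ->
  in_H2 (fun w => f w + c * g w).
Proof.
move=> fH gH; have [N NP] := line_int_bounded fH;
  have [M MP] := line_int_bounded gH.
have hh x y : 0 < x -> holo (fun w => f w + c * g w) (x +i* y).
  move=> x0; apply: holoD; first exact: H2_holo.
  by apply: holoM; [exact: holo_cst|exact: H2_holo].
pose k := 2 * normc c ^+ 2.
have k0 : 0 <= k by rewrite mulr_ge0// sqr_ge0.
apply: (@in_H2_intro _ (2 * N + k * M)) => // x x0.
have fi := sqn_integrable fH x0; have gi := sqn_integrable gH x0.
have fi2 : mu.-integrable setT (EFin \o (fun y => 2 * sqn f x y)).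
  exact: (@integrableZl _ _ R mu _ measurableT 2 _ fi).
have gi2 : mu.-integrable setT (EFin \o (fun y => k * sqn g x y)).
  exact: (@integrableZl _ _ R mu _ measurableT k _ gi).
apply: (@le_trans _ _ (\int[mu]_y (2 * sqn f x y + k * sqn g x y)%:E)%E).
  apply: ge0_le_integral => //.
  - by move=> y _; rewrite lee_fin sqn_ge0.
  - apply/measurable_EFinP; apply: continuous_measurable_fun.
    by apply: sqn_cont => y; exact: hh.
  - exact: (measurable_int _ (mu_integrableD measurableT fi2 gi2)).
  - move=> y _; rewrite lee_fin; apply: le_trans (sqr_normcD_le _ _) _.
    by rewrite /sqn /k ComplexField.Normc.normcM exprMn !mulrA.
rewrite -[leLHS]fineK; last first.
  by apply: integrable_fin_num => //;
    exact: (mu_integrableD measurableT fi2 gi2).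
rewrite lee_fin -/(Rintegral mu setT (fun y => 2 * sqn f x y + k * sqn g x y)).
rewrite (@RintegralD _ _ R mu setT _ _ measurableT fi2 gi2).
rewrite (@RintegralZl _ _ R mu setT _ 2 measurableT fi).
rewrite (@RintegralZl _ _ R mu setT _ k measurableT gi).
by apply: lerD; apply: ler_wpM2l => //; [exact: NP|exact: MP].
Qed.

Lemma in_H2_scale g (c : C) : in_H2 g -> in_H2 (fun w => c * g w).
Proof.
move=> gH; have := in_H2_lin (c - 1) gH gH.
by apply: in_H2_ext => w _; ring.
Qed.

Definition kern (w z : C) : C := (z + conjc w)^-1.

Lemma kern_den_neq0 (w z : C) : Cplus w -> Cplus z -> z + conjc w != 0.
Proof.
move=> w0 z0; apply: neq0_Re; rewrite ReD ReJ gt_eqF//.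
exact: addr_gt0.
Qed.

Lemma sqn_kern w x y :
  sqn (kern w) x y = ((Re w + x) ^+ 2 + (y - Im w) ^+ 2)^-1.
Proof.
rewrite /sqn /kern ComplexField.Normc.normcV exprVn sqr_normcE !ReImE /=.
by rewrite addrC [x + _]addrC addrC.
Qed.

Lemma in_H2_kern w : Cplus w -> in_H2 (kern w).
Proof.
move=> w0; apply: (@in_H2_intro _ (pi / Re w)) => [x y x0|x x0].
  apply: holoV; first exact: kern_den_neq0.
  by apply: holoD; [exact: holo_id|exact: holo_cst].
under eq_integral do rewrite sqn_kern.
rewrite integral_poisson ?addr_gt0// lee_fin ler_wpM2l ?pi_ge0//.
by rewrite lef_pV2 ?posrE ?addr_gt0// lerDl ltW.
Qed.

(** * Composition with the affine automorphisms az + ib *)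

Section Affine.
Variables (a b : R).
Hypothesis a0 : 0 < a.

Definition affine (z : C) : C := a%:C * z + b*i.

Lemma affineE x y : affine (x +i* y) = (a * x) +i* (a * y + b).
Proof. by apply: ReImP; rewrite !ReImE /=; ring. Qed.

(** Stated for the extended integral, so that it also serves to prove that the composite lies in
    H^2. *)
Lemma line_int_affine f x : in_H2 f -> 0 < x ->
  (\int[mu]_y (sqn (f \o affine) x y)%:E = (a^-1 * line_int f (a * x))%:E)%E.
Proof.
move=> fH x0; have ax0 : 0 < a * x by exact: mulr_gt0.
have fc : continuous (sqn f (a * x)) by apply: sqn_cont => y; exact: H2_holo.
have sE y : sqn (f \o affine) x y = sqn f (a * x) (a * y + b).
  by rewrite /sqn /= affineE.
under eq_integral do rewrite sE.
have fi : (\int[mu]_y (sqn f (a * x) y)%:E)%E = (line_int f (a * x))%:E.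
  rewrite /line_int /Rintegral fineK//.
  by apply: integrable_fin_num => //; exact: sqn_integrable.
rewrite EFinM -fi (@integral_affine _ (sqn f (a * x)) a b a0 fc (sqn_ge0 _ _)).
have a'0 : 0 <= a^-1 by rewrite invr_ge0 ltW.
rewrite -ge0_integralZl//.
- by apply: eq_integral => y _; rewrite -EFinM mulrCA mulVf ?mulr1// gt_eqF.
- apply/measurable_EFinP; apply: continuous_measurable_fun => y.
  have c1 : {for y, continuous (fun y => sqn f (a * x) (a * y + b))}.
    apply: (@continuous_comp _ _ _ (fun y => a * y + b) (sqn f (a * x))).
      exact: continuous_affine.
    exact: fc.
  exact: (@continuousM _ _ (fun y => sqn f (a * x) (a * y + b)) (cst a) _ c1
    (@cst_continuous _ _ _ _)).
- by move=> y _; rewrite lee_fin mulr_ge0 ?sqn_ge0// ltW.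
Qed.

Lemma in_H2_affine f : in_H2 f -> in_H2 (f \o affine).
Proof.
move=> fH; have [N NP] := line_int_bounded fH.
apply: (@in_H2_intro _ (a^-1 * N)) => [x y x0|x x0].
  apply: holo_affine; rewrite -/(affine _) affineE; apply: H2_holo => //.
  exact: mulr_gt0.
rewrite line_int_affine// lee_fin ler_wpM2l ?invr_ge0 ?(ltW a0)//.
by apply: NP; exact: mulr_gt0.
Qed.

Lemma H2_norm_affine_le f : in_H2 f ->
  H2_norm (f \o affine) ^+ 2 <= a^-1 * H2_norm f ^+ 2.
Proof.
move=> fH; apply: H2_norm_le; first exact: in_H2_affine.
move=> x x0; have -> : line_int (f \o affine) x = a^-1 * line_int f (a * x).
  by rewrite {1}/line_int /Rintegral line_int_affine.
rewrite mulrCA ler_wpM2l ?invr_ge0 ?(ltW a0)//; apply: line_int_le => //.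
exact: mulr_gt0.
Qed.

End Affine.

Lemma affineK (a b : R) : a != 0 -> cancel (affine a b) (affine a^-1 (- b / a)).
Proof.
move=> an0 [x y]; rewrite !affineE; apply: ReImP => /=; by field.
Qed.

Lemma affineVK (a b : R) : a != 0 ->
  cancel (affine a^-1 (- b / a)) (affine a b).
Proof.
move=> an0 [x y]; rewrite !affineE; apply: ReImP => /=; by field.
Qed.

(** The reverse inequality is [H2_norm_affine_le] for the inverse map, whose scale is a^-1. *)
Lemma H2_norm_affine (a b : R) f : 0 < a -> in_H2 f ->
  H2_norm (f \o affine a b) ^+ 2 = a^-1 * H2_norm f ^+ 2.
Proof.
move=> a0 fH; apply/eqP; rewrite eq_le H2_norm_affine_le//=.
have a'0 : 0 < a^-1 by rewrite invr_gt0.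
have := @H2_norm_affine_le a^-1 (- b / a) a'0 _ (in_H2_affine b a0 fH).
have -> : (f \o affine a b) \o affine a^-1 (- b / a) = f.
  by apply/funext => z /=; rewrite affineVK// gt_eqF.
by rewrite invrK -ler_pdivrMl// mulrC.
Qed.

End HardySpace.

(** * The Cauchy formula *)

Section Cauchy.
Context {R : realType}.
Local Notation C := R[i].
Local Notation mu := (@lebesgue_measure R).
Implicit Types (f g : C -> C).

Lemma continuous_poisson (t m : R) : t != 0 ->
  continuous (fun y : R => (t ^+ 2 + (y - m) ^+ 2)^-1).
Proof.
move=> t0 y.
have D0 u : t ^+ 2 + (u - m) ^+ 2 != 0.
  by rewrite gt_eqF// ltr_pwDl ?sqr_ge0// lt_neqAle eq_sym expf_neq0//= sqr_ge0.
apply: (@continuousV _ _ (fun y : R => t ^+ 2 + (y - m) ^+ 2)); first exact: D0.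
apply: (@continuousD _ _ _ (cst (t ^+ 2)) (fun y : R => (y - m) ^+ 2)).
  exact: cst_continuous.
have c1 : {for y, continuous (fun y : R => y - m)}.
  have := @continuous_affine R 1 (- m) y.
  by under eq_fun do rewrite mul1r.
exact: (@continuousM _ _ (fun y : R => y - m) _ _ c1 c1).
Qed.

(** Here [t] is the signed distance from a line to the pole, so both signs occur. *)
Lemma poisson_integrable (t m : R) : t != 0 ->
  mu.-integrable setT (EFin \o (fun y => (t ^+ 2 + (y - m) ^+ 2)^-1)) /\
  \int[mu]_y (t ^+ 2 + (y - m) ^+ 2)^-1 = pi / `|t|.
Proof.
move=> t0; have t0' : 0 < `|t| by rewrite normr_gt0.
have := integral_poisson m t0'; rewrite real_normK ?num_real// => I.
split; last by rewrite /Rintegral I.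
apply/integrableP; split.
  apply/measurable_EFinP; apply: continuous_measurable_fun.
  exact: continuous_poisson.
under eq_integral do rewrite /= ger0_norm ?invr_ge0 ?addr_ge0 ?sqr_ge0//.
by rewrite I ltry.
Qed.

(** A point on the same side of the line as p is no farther from p than from its mirror image, so |z
    - q| in a denominator may be replaced by |p - z|. *)
Lemma reflection_farther (p z : C) (x : R) : x <= Re z -> x <= Re p ->
  normc (p - z) <= normc (z - ((x + x)%:C - conjc p)).
Proof.
move=> xz xp; rewrite -ler_sqr ?nnegrE ?normc_ge0// !sqr_normcE !ReImE /=.
rewrite -subr_ge0.
have -> : (Re z - (x + x - Re p)) ^+ 2 + (Im z - (0 - - Im p)) ^+ 2 -
  ((Re p - Re z) ^+ 2 + (Im p - Im z) ^+ 2) = 4 * ((Re p - x) * (Re z - x)).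
  by ring.
by rewrite mulr_ge0// mulr_ge0// subr_ge0.
Qed.

Section Formula.
Variables (f : C -> C) (p : C) (x : R).
Hypotheses (fH : in_H2 f) (x0 : 0 < x) (xp : x < Re p).

(* [q] is the reflection of [p] in the line [Re z = x], so that on this line
   [(p - z) * (z - q) = |p - z|^2] and [g] is the Cauchy integrand minus a
   multiple of the Poisson kernel; this [g] is bounded near [p]. *)
Let s := Re p - x.
Let q : C := (x + x)%:C - conjc p.
Let g (z : C) : C := (f z - f p) / (p - z) - f p / (z - q).

Let s0 : 0 < s. Proof. by rewrite subr_gt0. Qed.

Let Req : Re q = x + x - Re p. Proof. by rewrite !ReImE. Qed.

Let zq0 z : x - s < Re z -> z - q != 0.
Proof.
move=> xz; apply: neq0_Re; rewrite ReD ReN Req gt_eqF// subr_gt0.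
by apply: le_lt_trans xz; rewrite /s; lra.
Qed.

Let xs z : x <= Re z -> x - s < Re z.
Proof. by apply: lt_le_trans; rewrite ltrBlDr ltrDl. Qed.

(** Partial fractions: 2 s = (p - z) + (z - q), so the two terms containing f(p) combine into one
    that decays quadratically. *)
Let gE z : x <= Re z -> z != p ->
  g z = f z / (p - z) - (s + s)%:C * f p / ((p - z) * (z - q)).
Proof.
move=> xz zp; have pz0 : p - z != 0 by rewrite subr_eq0 eq_sym.
have zq := zq0 (xs xz).
have -> : (s + s)%:C = (p - z) + (z - q).
  by rewrite /s /q; apply: ReImP; rewrite !ReImE /=; ring.
by rewrite /g; field; rewrite pz0 zq.
Qed.

Let g_holo' z : Cplus z -> x - s < Re z -> z != p -> holo g z.
Proof.
move=> z0 xz zp.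
apply: holoB.
  apply: holoM; first by apply: holoB; [exact: fH.1|exact: holo_cst].
  apply: holoV; first by rewrite subr_eq0 eq_sym.
  by apply: holoB; [exact: holo_cst|exact: holo_id].
apply: holoM; first exact: holo_cst.
apply: holoV; first exact: zq0.
by apply: holoB; [exact: holo_id|exact: holo_cst].
Qed.

Let g_holo z : x <= Re z -> z != p -> holo g z.
Proof.
by move=> xz; apply: g_holo'; [exact: lt_le_trans xz|exact: xs].
Qed.

Let c (e : R) := (2 * e)^-1 + 2 * s * normc (f p).

(** The first summand of [c e] comes from the weighted inequality |f| / |p - z| <= e / 2 |f|^2 + 1 /
    (2 e |p - z|^2), the second from the Poisson term. The line integrals of |f|^2 are merely
    bounded, so the free weight [e] is what makes their share small. *)
Let g_le e z : 0 < e -> x <= Re z -> z != p ->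
  normc (g z) <= e / 2 * normc (f z) ^+ 2 + c e * (normc (p - z) ^+ 2)^-1.
Proof.
move=> e0 xz zp; rewrite gE//.
have pz : 0 < normc (p - z) by rewrite normc_gt0// subr_eq0 eq_sym.
have zq := reflection_farther xz (ltW xp); rewrite -/q in zq.
have zq' : 0 < normc (z - q) by exact: lt_le_trans zq.
apply: le_trans (le_normcD _ _) _; rewrite normcN.
rewrite !ComplexField.Normc.normcM !ComplexField.Normc.normcV.
rewrite !ComplexField.Normc.normcM normcR (gtr0_norm (addr_gt0 s0 s0)).
have cE w : c e * w = (2 * e)^-1 * w + 2 * s * normc (f p) * w by exact: mulrDl.
rewrite cE [leRHS]addrA; apply: lerD.
  set u := normc (f z); set v := normc (p - z) in pz *.
  have h := sqr_ge0 (e * u - v^-1).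
  rewrite sqrrB in h; rewrite -subr_ge0.
  have -> : e / 2 * u ^+ 2 + (2 * e)^-1 / v ^+ 2 - u / v =
     (2 * e)^-1 * ((e * u) ^+ 2 - e * u / v *+ 2 + v^-1 ^+ 2).
    by field; rewrite !gt_eqF.
  by apply: mulr_ge0 h; rewrite invr_ge0 mulr_ge0// ltW.
have -> : s + s = 2 * s by rewrite mulr2n mulrDl mul1r.
apply: ler_wpM2l; first by rewrite !mulr_ge0 ?normc_ge0// ltW.
rewrite lef_pV2 ?posrE ?exprn_gt0 ?mulr_gt0//.
by rewrite expr2 ler_wpM2l// ltW.
Qed.

Let c_ge0 e : 0 < e -> 0 <= c e.
Proof.
move=> e0; rewrite addr_ge0 ?invr_ge0 ?mulr_ge0 ?normc_ge0//; exact: ltW.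
Qed.

(** The difference quotient of f is at most |l| + 1 near p, and within distance s of p one has |z -
    q| >= s. *)
Let g_bounded : exists M r, 0 < r /\
  forall z, z != p -> normc (z - p) < r -> normc (g z) <= M.
Proof.
have p0 : Cplus p by exact: lt_trans xp.
have [l lP] := (proj1 (holoP _ _)) (fH.1 _ p0).
have [d d0 dP] := lP 1 ltr01.
exists (normc l + 1 + normc (f p) / s), (Num.min d s); split.
  by rewrite lt_min d0.
move=> z zp; rewrite lt_min => /andP[zd zs].
have pz : 0 < normc (p - z) by rewrite normc_gt0// subr_eq0 eq_sym.
apply: le_trans (le_normcD _ _) _; rewrite normcN.
rewrite !ComplexField.Normc.normcM !ComplexField.Normc.normcV; apply: lerD.
  rewrite ler_pdivrMr// (normcB p).
  have := dP _ zd; rewrite [p + _]addrC subrK mul1r => H.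
  have {1}-> : f z - f p = (f z - f p - l * (z - p)) + l * (z - p)
    by rewrite [RHS]subrK.
  apply: le_trans (le_normcD _ _) _; rewrite ComplexField.Normc.normcM.
  by rewrite mulrDl mul1r addrC lerD2l.
apply: ler_wpM2l; first exact: normc_ge0.
have sq : s <= normc (z - q).
  apply: le_trans (Re_le_normc _); apply: le_trans (ler_norm _).
  have := le_trans (Re_le_normc _) (ltW zs).
  by rewrite !ReD !ReN Req ler_norml /s => /andP[]; lra.
by rewrite lef_pV2 ?posrE// (lt_le_trans s0).
Qed.

Let denE u y : normc (p - (u +i* y)) ^+ 2 = (u - Re p) ^+ 2 + (y - Im p) ^+ 2.
Proof. by rewrite sqr_normcE !ReImE /=; ring. Qed.

Let line_neq u y : u != Re p -> u +i* y != p.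
Proof. by apply: contraNneq => <-. Qed.

Let maj e u y :=
  e / 2 * sqn f u y + c e * ((u - Re p) ^+ 2 + (y - Im p) ^+ 2)^-1.

Let maj_integrable e u : 0 < u -> u != Re p ->
  mu.-integrable setT (EFin \o maj e u) /\
  \int[mu]_y maj e u y = e / 2 * line_int f u + c e * (pi / `|u - Re p|).
Proof.
move=> u0 up; have up0 : u - Re p != 0 by rewrite subr_eq0.
have [pii piE] := poisson_integrable (Im p) up0.
have fi := sqn_integrable fH u0.
have i1 := @integrableZl _ _ R mu _ measurableT (e / 2) _ fi.
have i2 := @integrableZl _ _ R mu _ measurableT (c e) _ pii.
split; first exact: (mu_integrableD measurableT i1 i2).
rewrite (@RintegralD _ _ R mu setT _ _ measurableT i1 i2).
rewrite (@RintegralZl _ _ R mu setT _ (e / 2) measurableT fi).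
by rewrite (@RintegralZl _ _ R mu setT _ (c e) measurableT pii) piE.
Qed.

Let g_integrable u : x <= u -> u != Re p ->
  mu.-integrable setT (EFin \o (fun y => Re (g (u +i* y)))).
Proof.
move=> xu up; have u0 : 0 < u by exact: lt_le_trans xu.
have [mi _] := maj_integrable 1 u0 up.
apply: (dominated_integrable _ mi).
  by move=> y; apply: Re_cont_v; apply: g_holo => //; exact: line_neq.
move=> y; apply: le_trans (Re_le_normc _) _.
apply: le_trans (g_le ltr01 _ _) _ => //; first exact: line_neq.
by rewrite denE.
Qed.

(** The lines Re z = x and Re z = X enclose p, where [g] is bounded, so [goursat_puncture] handles
    the rectangles. *)
Let g_move X : Re p < X ->
  \int[mu]_y Re (g (x +i* y)) = \int[mu]_y Re (g (X +i* y)).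
Proof.
move=> pX; have [N NP] := line_int_bounded fH.
have xX : x < X by exact: lt_trans pX.
have [M [r [r0 rM]]] := g_bounded.
have xnp : x != Re p by rewrite lt_eqF.
have Xnp : X != Re p by rewrite gt_eqF.
(* Beyond this height |y - Im p| >= 1, so horizontal edges and tails stay away from p. *)
pose T := `|Im p| + 1.
have far y : T < `|y| -> 1 <= (y - Im p) ^+ 2.
  move=> Ty; have : 1 <= `|y - Im p|.
    by have := lerB_dist y (Im p); rewrite /T in Ty; lra.
  by move=> h; rewrite -(real_normK (num_real (y - Im p))) expr_ge1.
have T_neq u y : T < `|y| -> u +i* y != p.
  move=> /far; apply: contraL => /eqP <- /=.
  by rewrite subrr expr0n /= -ltNge ltr01.
have [pii piE] := @poisson_integrable 1 (Im p) (oner_neq0 _).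
(* A majorant whose Poisson part does not depend on u, so that it also covers the line through p: if
   (y - Im p)^2 >= 1, then 1 / ((u - Re p)^2 + (y - Im p)^2) <= 2 / (1 + (y - Im p)^2). *)
pose m u y := 1 / 2 * sqn f u y + c 1 * 2 * (1 ^+ 2 + (y - Im p) ^+ 2)^-1.
(* The left margin must keep Re z > 0 for [f] and Re z > x - s = Re q for the pole at q. *)
apply: (@line_integral_eq _ g (Num.max 0 (x - s)) x X (X + 1) T (1 / 2 * N +
  c 1 * 2 * pi)).
- by rewrite gt_max x0 ltrBlDr ltrDl.
- exact: ltW.
- by rewrite ltrDl.
- move=> u y /andP[]; rewrite gt_max => /andP[u0 us] _ Ty.
  by apply: g_holo' => //; exact: T_neq.
- move=> u t uT tT.
  have Tp : `|Im p| < T by rewrite ltrDl.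
  apply: (@goursat_puncture _ g x X u t (Re p) (Im p) M r) => //.
  + by rewrite xp pX.
  + by move: Tp; rewrite ltr_norml => /andP[? ?]; apply/andP; split; lra.
  + move=> v y /andP[xv _] _ vy; apply: g_holo => //.
    by apply: contraTneq vy => <- /=; rewrite !eqxx.
  + by move=> z; have -> : Re p +i* Im p = p by [case: (p)]; exact: rM.
- move=> u /andP[xu uX].
  have u0 : 0 < u by exact: lt_le_trans xu.
  have fi := sqn_integrable fH u0.
  have i1 := @integrableZl _ _ R mu _ measurableT (1 / 2) _ fi.
  have i2 := @integrableZl _ _ R mu _ measurableT (c 1 * 2) _ pii.
  have c2 : 0 <= c 1 * 2 by rewrite mulr_ge0// c_ge0.
  apply: (@tail_integral_le _ T _ (m u)).
  + by move=> y Ty; apply: normc_cont_v; apply: g_holo => //; exact: T_neq.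
  + exact: (mu_integrableD measurableT i1 i2).
  + move=> y; apply: addr_ge0; apply: mulr_ge0 => //; first exact: sqn_ge0.
    by rewrite invr_ge0 addr_ge0// sqr_ge0.
  + move=> y Ty; apply/andP; split; first exact: normc_ge0.
    apply: le_trans (g_le ltr01 _ (T_neq u y Ty)) _ => //.
    rewrite denE lerD2l -mulrA ler_wpM2l ?c_ge0//.
    have h := far y Ty; have h2 := sqr_ge0 (u - Re p).
    have D1 : 0 < (u - Re p) ^+ 2 + (y - Im p) ^+ 2 by lra.
    have D2 : 0 < 1 ^+ 2 + (y - Im p) ^+ 2 by rewrite expr1n; lra.
    by rewrite ler_pdivlMr// mulrC ler_pdivrMr// expr1n; lra.
  + rewrite (@RintegralD _ _ R mu setT _ _ measurableT i1 i2).
    rewrite (@RintegralZl _ _ R mu setT _ (1 / 2) measurableT fi).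
    rewrite (@RintegralZl _ _ R mu setT _ (c 1 * 2) measurableT pii) piE.
    by rewrite normr1 divr1 lerD2r ler_wpM2l// NP.
- exact: g_integrable.
- by apply: g_integrable => //; exact: ltW.
Qed.

(** Move the line to X = Re p + t. The majorant integrates to at most h / 2 N + c(h) pi / t, which
    is made small by choosing first h, then t. *)
Let g_zero : \int[mu]_y Re (g (x +i* y)) = 0.
Proof.
have [N NP] := line_int_bounded fH.
have N0 : 0 <= N by apply: le_trans (line_int_ge0 f 1) (NP 1 ltr01).
apply/eqP; rewrite -normr_le0; apply/ler_addgt0Pr => e e0; rewrite add0r.
have N1 : 0 < N + 1 by rewrite ltr_wpDl.
(* This gives h N <= e, and the [t] below satisfies e / 2 t = c(h) pi + e / 2, so each summand is at
   most e / 2. *)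
pose h := e / (N + 1); have h0 : 0 < h by rewrite divr_gt0.
have ch := c_ge0 h0; have pi0 := pi_ge0 R.
pose t := 2 * (c h * pi) / e + 1.
have cp0 : 0 <= c h * pi by exact: mulr_ge0.
have t0 : 0 < t by rewrite ltr_wpDl// divr_ge0// ?mulr_ge0// ltW.
have pX : Re p < Re p + t by rewrite ltrDl.
rewrite (g_move pX); set X := Re p + t in pX *.
have X0 : 0 < X by apply: lt_trans pX; exact: lt_trans xp.
have Xnp : X != Re p by rewrite gt_eqF.
have xX : x <= X by rewrite ltW// (lt_trans xp).
have [mi mE] := maj_integrable h X0 Xnp.
apply: le_trans (@le_normr_Rintegral _ _ R mu setT _ measurableT
  (g_integrable xX Xnp)) _.
apply: (@le_trans _ _ (\int[mu]_y maj h X y)).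
  apply: le_Rintegral => //; first exact: integrable_norm (g_integrable xX Xnp).
  move=> y _; apply: le_trans (Re_le_normc _) _.
  apply: le_trans (g_le h0 _ _) _ => //; first exact: line_neq.
  by rewrite denE.
have Xp : X - Re p = t by rewrite /X addrC addKr.
rewrite mE Xp (gtr0_norm t0) [leRHS]splitr.
apply: lerD.
  rewrite mulrAC ler_pM2r ?invr_gt0//;
    apply: le_trans (ler_wpM2l (ltW h0) (NP X X0)) _.
  by rewrite /h mulrAC ler_pdivrMr// ler_wpM2l// ?lerDl// ltW.
rewrite mulrA ler_pdivrMr//.
have -> : e / 2 * t = c h * pi + e / 2 by rewrite /t; field; rewrite gt_eqF.
by rewrite lerDl divr_ge0// ltW.
Qed.

(** Since [g] integrates to 0, only the Poisson term remains: 2 s Re f(p) times pi / s. *)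
Lemma cauchy_formula :
  \int[mu]_y Re (f (x +i* y) / (p - (x +i* y))) = 2 * pi * Re (f p).
Proof.
have xnp : x != Re p by rewrite lt_eqF.
have [pii piE] := poisson_integrable (Im p)
  (t := x - Re p) ltac:(by rewrite subr_eq0).
have gx y : Re (f (x +i* y) / (p - (x +i* y))) = Re (g (x +i* y)) +
    2 * s * Re (f p) * ((x - Re p) ^+ 2 + (y - Im p) ^+ 2)^-1.
  rewrite gE//=; last exact: line_neq.
  set z := x +i* y; set D := (x - Re p) ^+ 2 + (y - Im p) ^+ 2.
  have -> : (p - z) * (z - q) = D%:C.
    by rewrite /D /q; apply: ReImP; rewrite !ReImE /=; ring.
  have -> : (s + s)%:C * f p / D%:C = ((s + s) * D^-1)%:C * f p.
    by rewrite rmorphM /= fmorphV /= mulrAC.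
  rewrite ReD ReN [Re (_%:C * _)]ReM /= mul0r subr0; ring.
under eq_Rintegral do rewrite gx.
have i2 := @integrableZl _ _ R mu _ measurableT (2 * s * Re (f p)) _ pii.
rewrite (@RintegralD _ _ R mu setT _ _ measurableT (g_integrable
  (lexx x) xnp) i2).
rewrite g_zero add0r.
rewrite (@RintegralZl _ _ R mu setT _ (2 * s * Re (f p)) measurableT pii) piE.
rewrite -normrN opprB -/s gtr0_norm//; field; rewrite gt_eqF//.
Qed.

End Formula.

End Cauchy.

(** * The inner product *)

Section InnerProduct.
Context {R : realType}.
Local Notation C := R[i].
Local Notation mu := (@lebesgue_measure R).
Implicit Types (f g : C -> C) (c : C).

(** This plays the part of Re <f, c g>; the values c = 1 and c = i are the real and imaginary parts
    of [H2_inner f g]. *)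
Definition polar f g c : R := 4^-1 * (H2_norm (fun w => f w + c * g w) ^+ 2 -
  H2_norm (fun w => f w + - c * g w) ^+ 2).

Definition line_inner f g c x : R :=
  \int[mu]_y Re (f (x +i* y) * conjc (c * g (x +i* y))).

Lemma sum_ord4 (F : nat -> C) :
  \sum_(k < 4) F k = F 0%N + F 1%N + F 2%N + F 3%N.
Proof. by rewrite !big_ord_recr /= big_ord0 add0r. Qed.

Lemma polarization_sum (a b d e : R) :
  4^-1 * (1 * a%:C + 'i%C * b%:C + -1 * d%:C + - 'i%C * e%:C) =
  (4^-1 * (a - d)) +i* (4^-1 * (b - e)) :> C.
Proof.
have -> : 4^-1 = (4^-1)%:C :> C by rewrite fmorphV /= rmorph_nat.
by apply: ReImP; rewrite !ReImE /=; ring.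
Qed.

Lemma H2_innerE f g : H2_inner f g = polar f g 1 +i* polar f g 'i%C.
Proof.
rewrite /H2_inner (sum_ord4 (fun k => 'i%C ^+ k *
  (H2_norm (fun w => f w + 'i%C ^+ k * g w) ^+ 2)%:C)).
have i2 : 'i%C * 'i%C = -1 :> C by rewrite -expr2 sqr_i.
have -> : 'i%C ^+ 0 = 1 :> C by [].
have -> : 'i%C ^+ 1 = 'i%C :> C by [].
have -> : 'i%C ^+ 2 = -1 :> C by rewrite expr2.
have -> : 'i%C ^+ 3 = - 'i%C :> C by rewrite exprS expr2 i2 mulrN1.
exact: polarization_sum.
Qed.

Lemma line_inner_polar f g c x : in_H2 f -> in_H2 g -> 0 < x ->
  line_inner f g c x = 4^-1 * (line_int (fun w => f w + c * g w) x -
    line_int (fun w => f w + - c * g w) x).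
Proof.
move=> fH gH x0.
have i1 := sqn_integrable (in_H2_lin c fH gH) x0.
have i2 := sqn_integrable (in_H2_lin (- c) fH gH) x0.
rewrite /line_int -(@RintegralB _ _ R mu setT _ _ measurableT i1 i2).
rewrite -(@RintegralZl _ _ R mu setT _ 4^-1 measurableT
  (mu_integrableB measurableT i1 i2)).
apply: eq_Rintegral => y _.
by rewrite /sqn !sqr_normcE !ReImE; field.
Qed.

Lemma line_inner_integrable f g c x : in_H2 f -> in_H2 g -> 0 < x ->
  mu.-integrable setT (EFin \o (fun y =>
    Re (f (x +i* y) * conjc (c * g (x +i* y))))).
Proof.
move=> fH gH x0.
have i1 := sqn_integrable (in_H2_lin c fH gH) x0.
have i2 := sqn_integrable (in_H2_lin (- c) fH gH) x0.
apply: eq_integrable (@integrableZl _ _ R mu _ measurableT 4^-1 _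
  (mu_integrableB measurableT i1 i2)) => // y _ /=.
by rewrite -EFinM; congr EFin; rewrite /sqn !sqr_normcE !ReImE; field.
Qed.

Lemma cvg_at0_scale (k l : R) (h : R -> R) :
  h x @[x --> 0^'+] --> l -> k * h x @[x --> 0^'+] --> k * l.
Proof. by move=> hl; exact: cvgMl_tmp. Qed.

Lemma cvg_at0_sub (l m : R) (h k : R -> R) :
  h x @[x --> 0^'+] --> l -> k x @[x --> 0^'+] --> m ->
  h x - k x @[x --> 0^'+] --> l - m.
Proof. by move=> hl km; exact: cvgB. Qed.

Lemma polar_cvg f g c : in_H2 f -> in_H2 g ->
  pi^-1 * line_inner f g c x @[x --> 0^'+] --> polar f g c.
Proof.
move=> fH gH.
have h1 := H2_norm_cvg (in_H2_lin c fH gH).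
have h2 := H2_norm_cvg (in_H2_lin (- c) fH gH).
have H : 4^-1 * (pi^-1 * line_int (fun w => f w + c * g w) x -
    pi^-1 * line_int (fun w =>
      f w + - c * g w) x) @[x --> 0^'+] --> polar f g c.
  exact: cvg_at0_scale (cvg_at0_sub h1 h2).
apply: cvg_trans H; apply: near_eq_cvg; near=> x.
have x0 : 0 < x by [].
by rewrite /= line_inner_polar//; ring.
Unshelve. all: by end_near. Qed.

(** An identity between inner products thus needs checking only on each line, where it can be read
    off the integrands. Conjugate symmetry and real homogeneity are obtained this way. *)
Lemma polar_unique f g c f' g' c' (k : R) : in_H2 f -> in_H2 g ->
  in_H2 f' -> in_H2 g' ->
  (forall x, 0 < x -> k * line_inner f g c x = line_inner f' g' c' x) ->
  k * polar f g c = polar f' g' c'.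
Proof.
move=> fH gH f'H g'H kE;
  have H : k * (pi^-1 * line_inner f g c x) @[x --> 0^'+] --> k * polar f g c.
  exact: cvg_at0_scale (polar_cvg fH gH).
have H' := polar_cvg (c := c') f'H g'H.
apply: (cvg_unique _ H); last first.
  apply: cvg_trans H'; apply: near_eq_cvg; near=> x.
  have x0 : 0 < x by [].
  by rewrite /= mulrCA kE.
Unshelve. all: by end_near. Qed.

Lemma H2_inner_conj f g : in_H2 f -> in_H2 g ->
  H2_inner g f = conjc (H2_inner f g).
Proof.
move=> fH gH; rewrite (H2_innerE g f) (H2_innerE f g).
have -> : polar g f 1 = polar f g 1.
  rewrite -[LHS]mul1r; apply: (polar_unique gH fH fH gH) => x x0; rewrite mul1r.
  by apply: eq_Rintegral => y _; rewrite !ReImE /=; ring.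
suff -> : polar g f 'i%C = - polar f g 'i%C by [].
rewrite -mulN1r; apply/esym; apply: (polar_unique fH gH gH fH) => x x0.
rewrite -(@RintegralZl _ _ R mu setT _ (-1) measurableT
  (line_inner_integrable _ fH gH x0)).
by apply: eq_Rintegral => y _; rewrite !ReImE /=; ring.
Qed.

Lemma polar_scale f g c (a : R) : in_H2 f -> in_H2 g ->
  polar f (fun w => a%:C * g w) c = a * polar f g c.
Proof.
move=> fH gH; have agH := in_H2_scale a%:C gH.
apply/esym; apply: (polar_unique fH gH fH agH) => x x0.
rewrite -(@RintegralZl _ _ R mu setT _ a measurableT
  (line_inner_integrable _ fH gH x0)).
by apply: eq_Rintegral => y _; rewrite !ReImE /=; ring.
Qed.

Lemma realM_complex (a p q : R) : (a * p) +i* (a * q) = a%:C * (p +i* q) :> C.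
Proof. by apply: ReImP; rewrite !ReImE /=; ring. Qed.

Lemma H2_inner_scale f g (a : R) : in_H2 f -> in_H2 g ->
  H2_inner f (fun w => a%:C * g w) = a%:C * H2_inner f g.
Proof.
move=> fH gH; rewrite (H2_innerE f g) H2_innerE !(polar_scale _ _ fH gH).
exact: realM_complex.
Qed.

(** On Re z = x the conjugate of K_w(z) is 1 / (p - z) with p = w + 2 x, so the Cauchy formula
    evaluates the line integral as 2 pi Re f(w + 2 x); then x tends to 0. *)
Lemma polar_kern f w : in_H2 f -> Cplus w -> polar f (kern w) 1 = 2 * Re (f w).
Proof.
move=> fH w0; have H := polar_cvg (c := 1) fH (in_H2_kern w0).
apply: (cvg_unique _ H) => {H}; last first.
have fc : Re (f (w + (x + x)%:C)) @[x --> 0^'+] --> Re (f w).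
  apply/cvgrPdist_lt => e e0; have [d d0 dP] := holo_cont (fH.1 _ w0) e0.
  near=> x; have x0 : 0 < x by [].
  rewrite distrC -ReN -ReD; apply: le_lt_trans (Re_le_normc _) _; apply: dP.
  rewrite addrC addKr normcR gtr0_norm ?addr_gt0// -mulr2n -mulr_natr.
  by rewrite -ltr_pdivlMr//; near: x; apply: nbhs_right_lt; rewrite divr_gt0.
have H : 2 * Re (f (w + (x + x)%:C)) @[x --> 0^'+] --> 2 * Re (f w).
  exact: cvg_at0_scale fc.
apply: cvg_trans H.
apply: near_eq_cvg; near=> x; have x0 : 0 < x by [].
have xP : x < Re (w + (x + x)%:C).
  by rewrite ReD /=; have : 0 < Re w by []; lra.
rewrite /=; have pi0 : pi != 0 :> R by rewrite gt_eqF ?pi_gt0.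
transitivity (pi^-1 * (2 * pi * Re (f (w + (x + x)%:C)))).
  by rewrite mulrA [pi^-1 * _]mulrCA mulVf ?mulr1.
rewrite -(cauchy_formula fH x0 xP); congr (_ * _).
apply: eq_Rintegral => y _; congr (Re (_ * _)).
rewrite mul1r /kern /= conjc_inv; congr (_^-1).
by apply: ReImP; rewrite !ReImE /=; ring.
Unshelve. all: by end_near. Qed.

Lemma H2_inner_kern f w : in_H2 f -> Cplus w ->
  H2_inner f (kern w) = 2 * f w.
Proof.
move=> fH w0; have kH := in_H2_kern w0.
(* The imaginary part of f(w) is the real part of -i f(w). *)
have f'H := in_H2_scale (- 'i%C) fH.
have -> : 2 * f w = (2 * Re (f w)) +i* (2 * Re (- 'i%C * f w)).
  by apply: ReImP; rewrite !ReImE /=; ring.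
rewrite H2_innerE polar_kern// -(polar_kern f'H w0).
suff -> : polar f (kern w) 'i%C = polar (fun z => - 'i%C * f z) (kern w) 1
  by [].
rewrite -[LHS]mul1r; apply: (polar_unique fH kH f'H kH) => x x0; rewrite mul1r.
by apply: eq_Rintegral => y _; rewrite !ReImE /=; ring.
Qed.

End InnerProduct.

(** * The conjugations *)

Section Conjugation.
Context {R : realType}.
Local Notation C := R[i].
Implicit Types (f g : C -> C) (z w : C).

Lemma polar_ext f f' g g' c : eq_on_Cplus f f' -> eq_on_Cplus g g' ->
  polar f g c = polar f' g' c.
Proof.
move=> ff gg; have E d : H2_norm (fun w => f w + d * g w) =
    H2_norm (fun w => f' w + d * g' w).
  by apply: H2_norm_ext => w w0; rewrite ff ?gg.
by rewrite /polar !E.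
Qed.

Lemma H2_inner_ext f f' g g' : eq_on_Cplus f f' -> eq_on_Cplus g g' ->
  H2_inner f g = H2_inner f' g'.
Proof.
by move=> ff gg; rewrite (H2_innerE f g) (H2_innerE f' g') !(polar_ext _ ff gg).
Qed.

Lemma Cplus_neq0 z : Cplus z -> z != 0.
Proof. by move=> z0; apply: neq0_Re; rewrite gt_eqF. Qed.

Lemma Cplus_inv z : Cplus z -> Cplus z^-1.
Proof.
case: z => x y x0; rewrite /Cplus /=; apply: divr_gt0 => //.
by rewrite ltr_pwDl ?sqr_ge0 ?exprn_gt0.
Qed.

Lemma Cplus_conj z : Cplus z -> Cplus (conjc z).
Proof. by rewrite /Cplus /= ReJ. Qed.

Lemma Cplus_shift (r : R) z : Cplus z -> Cplus (z + r *i).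
Proof. by rewrite /Cplus /= ReD /= addr0. Qed.

Lemma oppi (r : R) : (- r)*i = - (r*i) :> C.
Proof. by apply: ReImP; rewrite /= ?oppr0. Qed.

Lemma conji (r : R) : conjc (r*i) = - (r*i) :> C.
Proof. by apply: ReImP; rewrite /= ?oppr0. Qed.

Lemma conjcV z : conjc z^-1 = (conjc z)^-1. Proof. exact: conjc_inv. Qed.
Lemma conjcD z w : conjc (z + w) = conjc z + conjc w.
Proof. exact: rmorphD. Qed.
Lemma conjcN z : conjc (- z) = - conjc z. Proof. exact: rmorphN. Qed.
Lemma conjcM z w : conjc (z * w) = conjc z * conjc w.
Proof. exact: rmorphM. Qed.

Lemma JrE (r : R) f z : Jr r f z =
  (z - r*i)^-1 * conjc (f ((conjc (z - r*i))^-1 + r*i)).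
Proof. by rewrite /Jr /composition /W0 /tau /= oppi. Qed.

Lemma Jr_ext (r : R) f g : eq_on_Cplus f g -> eq_on_Cplus (Jr r f) (Jr r g).
Proof.
move=> fg z z0; rewrite !JrE fg//.
by apply: Cplus_shift; apply: Cplus_inv; apply: Cplus_conj; rewrite -oppi;
  apply: Cplus_shift.
Qed.

Definition conj_kern (r : R) w z : C := (1 + (z - r*i) * (w - r*i))^-1.

Lemma Jr_kern (r : R) w : eq_on_Cplus (Jr r (kern w)) (conj_kern r w).
Proof.
move=> z z0; rewrite JrE /kern /conj_kern.
have z'0 : z - r*i != 0 by apply: Cplus_neq0; rewrite -oppi; exact: Cplus_shift.
move: (z - r*i) z'0 => z' z'0.
rewrite conjcV !conjcD conjcV !conjcK conji -invfM; congr (_^-1).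
have -> : z'^-1 - r*i + w = z'^-1 + (w - r*i) by ring.
by rewrite mulrDr mulfV.
Qed.

(** The involution property of J_r on kernels; it lets the symmetry J S J, applied to J K_w, bring S
    to act on K_w. *)
Lemma Jr_conj_kern (r : R) w : eq_on_Cplus (Jr r (conj_kern r w)) (kern w).
Proof.
move=> z z0; rewrite JrE /kern /conj_kern addrK.
have z'0 : z - r*i != 0 by apply: Cplus_neq0; rewrite -oppi; exact: Cplus_shift.
have -> : z + conjc w = (z - r*i) + conjc (w - r*i).
  by rewrite conjcD conjcN conji; ring.
move: (z - r*i) z'0 => z' z'0; move: (w - r*i) => w'.
rewrite conjcV conjcD conjc1 conjcM conjcV conjcK -invfM; congr (_^-1).
by rewrite mulrDr mulr1 mulVKf.
Qed.

(** With w' = w - ir, the function is w'^-1 K_u for u = conj(w'^-1) + ir, a multiple of a kernel. *)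
Lemma in_H2_conj_kern (r : R) w : Cplus w -> in_H2 (conj_kern r w).
Proof.
move=> w0; have w'0 : Cplus (w - r*i) by rewrite -oppi; exact: Cplus_shift.
have u0 : Cplus (conjc (w - r*i)^-1 + r*i).
  by apply: Cplus_shift; apply: Cplus_conj; exact: Cplus_inv.
apply: in_H2_ext (in_H2_scale (w - r*i)^-1 (in_H2_kern u0)) => z z0.
rewrite /kern /conj_kern -invfM; congr (_^-1).
rewrite conjcD conjcK conji (addrCA z) mulrDr mulfV ?Cplus_neq0//.
by rewrite (mulrC _ (z - _)).
Qed.

(** * From symmetry to a dilation about a boundary point *)

Section Forward.
Variables (phi : C -> C) (r : R).
Hypothesis phi_self : self_map_Cplus phi.
Hypothesis phi_maps : maps_H2 (composition phi).
Hypothesis phi_sym : symmetric_wrt (Jr r) (composition phi).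

Lemma symmetric_functional_equation z w : Cplus z -> Cplus w ->
  (phi z - r*i) * (w - r*i) = (z - r*i) * (phi w - r*i).
Proof.
move=> z0 w0; have [S [S_maps S_adj] JSJ] := phi_sym.
have fH := in_H2_conj_kern r w0.
have Jf := @Jr_conj_kern r w.
have JfH : in_H2 (Jr r (conj_kern r w)).
  by apply: in_H2_ext (in_H2_kern w0) => u u0; rewrite Jf.
have hH := S_maps _ JfH.
(* Testing against kernels: <K_u o phi, K_w> = 2 K_u(phi w) equals <K_u, S K_w>, the conjugate of 2
   (S K_w)(u). *)
have hE : eq_on_Cplus (S (Jr r (conj_kern r w))) (kern (phi w)).
  move=> u u0; have kuH := in_H2_kern u0.
  have := S_adj _ _ kuH JfH.
  have eT : eq_on_Cplus (composition phi (kern u)) (composition phi (kern u)).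
    by [].
  rewrite (H2_inner_ext eT Jf).
  rewrite (H2_inner_kern (phi_maps kuH) w0) (H2_inner_conj hH kuH).
  rewrite (H2_inner_kern hH u0) conjcM => H.
  have two0 : (2 : C) != 0 by rewrite pnatr_eq0.
  have two : conjc (2 : C) = 2 by exact: conjc_nat.
  move: H; rewrite two => /(mulfI two0) H.
  by rewrite -[LHS]conjcK -H /kern conjcV conjcD conjcK addrC.
have := JSJ _ fH z z0;
  rewrite (@Jr_ext r _ _ hE z z0) (@Jr_kern r (phi w) z z0).
rewrite /composition /= /conj_kern => /invr_inj /addrI.
exact.
Qed.

Hypothesis phi_neq_id : ~ eq_on_Cplus phi id.

Lemma symmetric_hyperbolic : hyperbolic_automorphism phi.
Proof.
have c0 : Cplus (1 + r*i : C) by apply: Cplus_shift; rewrite /Cplus /=.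
have [A phiE A0] : exists2 A, forall z, Cplus z -> phi z = (z - r*i) * A + r*i &
    0 < Re A.
  exists (phi (1 + r*i) - r*i) => [z z0|].
    have := symmetric_functional_equation z0 c0.
    by rewrite addrK mulr1 => /eqP; rewrite subr_eq => /eqP.
  by have := phi_self c0; rewrite /Cplus /= ReD ReN /= oppr0 addr0.
have ImA : Im A = 0.
  apply/eqP; apply: contraT => ImA0.
  (* The imaginary part is chosen so that (z - ir) A is purely imaginary; phi would send this point
     to the boundary. *)
  have z0 : Cplus (1 +i* (Re A / Im A + r) : C) by rewrite /Cplus /=.
  have := phi_self z0; rewrite phiE// /Cplus /=.
  have -> : Re ((1 +i* (Re A / Im A + r) - r*i) * A + r*i) = 0.
    rewrite !ReImE /=; field; exact: ImA0.
  by rewrite ltxx.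
have AE : A = (Re A)%:C by apply: ReImP.
exists (Re A), ((r * (1 - Re A))*i); split => //.
(* If A = 1, the dilation is the identity, which is excluded. *)
- have [h|h|h] := ltgtP (Re A) 1; [left|right|]; rewrite ?A0//.
  exfalso; apply: phi_neq_id => z z0; rewrite phiE// AE h.
  by rewrite mulr1 subrK.
- move=> z z0; rewrite phiE// {1}AE; apply: ReImP; rewrite !ReImE /=; ring.
Qed.

End Forward.

(** * From a hyperbolic automorphism to symmetry *)

Section Backward.
Variables (phi : C -> C) (a : R) (b : C).
Hypotheses (a0 : 0 < a) (a1 : a != 1) (b0 : Re b = 0).
Hypothesis phiE : eq_on_Cplus phi (fun w => a%:C * w + b).

Let bE : b = (Im b)*i. Proof. by apply: ReImP. Qed.

Let phi_affine : eq_on_Cplus phi (affine a (Im b)).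
Proof. by move=> z z0; rewrite phiE// /affine -bE. Qed.

Let psi := affine a^-1 (- Im b / a).

Let T_ext f : eq_on_Cplus (composition phi f) (f \o affine a (Im b)).
Proof. by move=> z z0; rewrite /composition /= phi_affine. Qed.

(** Since f o phi + d g = (f + d (g o psi)) o phi, the scaling of norms under phi transfers to the
    polarized form; this yields the adjoint. *)
Lemma polar_affine f g c : in_H2 f -> in_H2 g ->
  polar (f \o affine a (Im b)) g c = a^-1 * polar f (g \o psi) c.
Proof.
move=> fH gH; have a'0 : 0 < a^-1 by rewrite invr_gt0.
have gH' : in_H2 (g \o psi) := in_H2_affine (- Im b / a) a'0 gH.
have E d : (fun w => (f \o affine a (Im b)) w + d * g w) =
    (fun w => f w + d * (g \o psi) w) \o affine a (Im b).
  by apply/funext => w /=; rewrite /psi affineK// gt_eqF.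
have N d : H2_norm (fun w => (f \o affine a (Im b)) w + d * g w) ^+ 2 =
    a^-1 * H2_norm (fun w => f w + d * (g \o psi) w) ^+ 2.
  by rewrite (E d); exact: H2_norm_affine (in_H2_lin d fH gH').
have sub (X Y X' Y' : R) : X = a^-1 * X' -> Y = a^-1 * Y' ->
    4^-1 * (X - Y) = a^-1 * (4^-1 * (X' - Y')).
  by move=> -> ->; rewrite -mulrBr mulrCA.
exact: sub (N c) (N (- c)).
Qed.

(** In the coordinate z' = z - ir centred at the fixed point, the inversion 1 / conj z' turns
    division by a into multiplication by a. The weights of the two conjugations leave 1 / z' times a
    z', and the adjoint's factor a^-1 cancels the remaining a. *)
Lemma hyperbolic_symmetric :
  symmetric_wrt (Jr (Im b / (1 - a))) (composition phi).
Proof.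
have an0 : a != 0 by rewrite gt_eqF.
have a'0 : 0 < a^-1 by rewrite invr_gt0.
exists (fun g w => (a^-1)%:C * (g \o psi) w).
  split=> [g gH|f g fH gH].
    by apply: in_H2_scale; exact: in_H2_affine.
  have gH' : in_H2 (g \o psi) := in_H2_affine (- Im b / a) a'0 gH.
  rewrite (H2_inner_scale _ fH gH') (@H2_inner_ext _ _ _ _ (@T_ext f)
    (fun _ _ => erefl)).
  by rewrite (H2_innerE _ g) !polar_affine// realM_complex -H2_innerE.
move=> f fH z z0; set r := Im b / (1 - a).
rewrite T_ext// [RHS]/= JrE.
have z'0 : z - r*i != 0 by apply: Cplus_neq0; rewrite -oppi; exact: Cplus_shift.
have rE : Im b = r * (1 - a) by rewrite /r divfK// subr_eq0 eq_sym.
move: r rE z'0 => r rE z'0.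
have psiE v : psi (v + r*i) = (a^-1)%:C * v + r*i.
  by rewrite /psi /affine rE; apply: ReImP; rewrite !ReImE /=; field.
rewrite /comp psiE JrE addrK.
have azr : a%:C * (z - r*i) + r*i = affine a (Im b) z.
  by rewrite /affine rE; apply: ReImP; rewrite !ReImE /=; ring.
rewrite -azr; move: (z - r*i) z'0 => z' z'0.
have aC : conjc ((a^-1)%:C : C) = (a^-1)%:C by exact: conjc_real.
have aa : (a^-1)%:C * a%:C = 1 :> C by rewrite -rmorphM /= mulVf.
have aV : ((a^-1)%:C : C)^-1 = a%:C by rewrite fmorphV /= invrK.
have -> : (conjc ((a^-1)%:C * (conjc z')^-1))^-1 = a%:C * z'.
  by rewrite conjcM conjcV conjcK aC invfM invrK aV.
rewrite !conjcM conjcK conjcV conjcM conjcV conjcK aC invfM invrK aV.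
move: (f _) => F.
transitivity (((a^-1)%:C * a%:C) * (z'^-1 * z') * F); first by ring.
by rewrite aa mulVf// !mul1r.
Qed.

End Backward.

End Conjugation.

(** For phi = id the left side holds and the right side fails, whence [phi_neq_id]. *)
Theorem theorem4p5 (R : realType) (phi : R[i] -> R[i])
  (phi_self : self_map_Cplus phi)
  (phi_analytic : analytic_on_Cplus phi)
  (phi_bounded : bounded_on_H2 (composition phi))
  (phi_neq_id : ~ eq_on_Cplus phi id) :
  (exists r : R, symmetric_wrt (Jr r) (composition phi)) <->
  hyperbolic_automorphism phi.
Proof.
split=> [[r phi_sym]|[a [b [a01 b0 phiE]]]].
  exact: symmetric_hyperbolic phi_self phi_bounded.1 phi_sym phi_neq_id.
have a0 : 0 < a by case: a01 => [/andP[]//|]; exact: lt_trans.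
have a1 : a != 1 by case: a01 => [/andP[_ /lt_eqF->]|/gt_eqF->].
by exists (Im b / (1 - a)); exact: hyperbolic_symmetric.
Qed.
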